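(* For every integer $n$ with $2\le n\le 6$, the vector $\bm{U}_n$ of last swap times of the oriented swap process on $n$ particles and the point-to-line last passage percolation vector $\bm{V}_n$ with i.i.d. rate-$1$ exponential weights have the same joint distribution: $\bm{U}_n\overset{D}{=}\bm{V}_n$.
   Context: Oriented swap process (OSP) on $n$ particles: at time $t=0$, the particle labelled $j$ is in position $j$, for $j=1,\dots,n$. Each pair of adjacent positions $(k,k+1)$, $1\le k\le n-1$, is assigned an independent Poisson clock of rate $1$. When the clock of $(k,k+1)$ rings, the particles with labels $i,j$ currently at positions $k,k+1$ respectively swap if $i<j$, and nothing happens otherwise. The process is eventually absorbed in the reversed order $(n,n-1,\dots,1)$. Define $\bm{U}_n=(U_n(1),\dots,U_n(n-1))$ by $U_n(k):=$ the last time $t$ at which a (successful) swap occurs between positions $k$ and $k+1$. Last passage percolation vector: let $(X_{i,j})_{i,j\ge1}$ be i.i.d. exponential random variables of rate $1$, and define $L(i,j)$ recursively by $L(i,j)=\max\{L(i-1,j),L(i,j-1)\}+X_{i,j}$ for $i,j\ge 1$, with $L(i,j)=0$ if $i=0$ or $j=0$ (equivalently, $L(i,j)$ is the maximum of $\sum_{(a,b)\in\pi}X_{a,b}$ over up/right nearest-neighbour lattice paths $\pi$ from $(1,1)$ to $(i,j)$). Define $\bm{V}_n=(V_n(1),\dots,V_n(n-1))$ by $V_n(k):=L(n-k,k)$. $\overset{D}{=}$ denotes equality of joint distributions. *)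

(* Defs.v *)
From HB Require Import structures.
From mathcomp Require Import all_boot all_order all_algebra all_fingroup.
From mathcomp Require Import finmap.
From mathcomp Require Import all_classical all_reals all_analysis.

Set Implicit Arguments.
Unset Strict Implicit.
Unset Printing Implicit Defensive.

Import Order.TTheory GRing.Theory Num.Theory.
Import numFieldNormedType.Exports.

Local Open Scope classical_set_scope.
Local Open Scope ring_scope.

Section iid.
Context d (T : measurableType d) (R : realType) (P : probability T R).
Context (I : choiceType) (X : I -> {RV P >-> R}).

Definition mutually_independent : Prop :=
  forall (J : {fset I}) (B : I -> set R),
    (forall i, i \in J -> measurable (B i)) ->
    P (\bigcap_(i in [set` J]) X i @^-1` B i)
    = (\prod_(i <- J) P (X i @^-1` B i))%E.

Definition iid_exponential (rate : R) : Prop :=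
  mutually_independent /\
  forall i (B : set R), measurable B ->
    distribution P (X i) B = exponential_prob rate B.

End iid.

(* A configuration is a permutation s of 'I_n, with s i the label of the
   particle in position i.  Labels and positions start at 0: the clock
   k : 'I_n.-1 acts on the positions k and k.+1, that is, on the k.+1-st and
   k.+2-nd positions. *)
Section oriented_swap_process.
Variable n : nat.

Definition lpos (k : 'I_n.-1) : 'I_n := widen_ord (leq_pred n) k.

Lemma rpos_subproof (k : 'I_n.-1) : (k.+1 < n)%N.
Proof. by rewrite -ltn_predRL. Qed.

Definition rpos (k : 'I_n.-1) : 'I_n := Ordinal (rpos_subproof k).

(* Permutations compose as (s * t) i = t (s i), so that this exchanges the
   labels in positions k and k.+1. *)
Definition exchange (k : 'I_n.-1) (s : {perm 'I_n}) : {perm 'I_n} :=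
  (tperm (lpos k) (rpos k) * s)%g.

Definition osp_step (k : 'I_n.-1) (s : {perm 'I_n}) : {perm 'I_n} :=
  if (s (lpos k) < s (rpos k))%N then exchange k s else s.

Variable R : realType.

Definition left_value (eta : R -> {perm 'I_n}) (t : R) (s : {perm 'I_n}) :=
  \forall u \near t^'-, eta u = s.

(* eta : R -> {perm 'I_n} is only meaningful on [0, +oo[.  It is
   right-continuous with left limits for the discrete topology, and it
   changes only when a clock rings.  If two clocks ring simultaneously, which
   has probability 0, both have to give the same new configuration. *)
Definition osp_trajectory (rings : 'I_n.-1 -> set R) (eta : R -> {perm 'I_n})
    : Prop :=
  [/\ eta 0 = 1%g,
      forall t, 0 <= t -> \forall u \near t^'+, eta u = eta t &
      forall t, 0 < t -> exists s, [/\ left_value eta t s,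
        forall k, rings k t -> eta t = osp_step k s &
        (forall k, ~ rings k t) -> eta t = s]].

Definition swap_at (eta : R -> {perm 'I_n}) (k : 'I_n.-1) (t : R) : Prop :=
  0 < t /\ exists2 s, left_value eta t s & eta t = exchange k s.

Definition is_last_swap_time (eta : R -> {perm 'I_n}) (k : 'I_n.-1) (t : R)
    : Prop :=
  swap_at eta k t /\ forall u, swap_at eta k u -> u <= t.

(* When the gaps tau (k, l) are i.i.d. exponential variables of rate 1, the
   sets poisson_rings tau w k are independent Poisson clocks of rate 1. *)
Definition poisson_rings d (T : measurableType d) (P : probability T R)
    (tau : 'I_n.-1 * nat -> {RV P >-> R}) (w : T) (k : 'I_n.-1) : set R :=
  [set \sum_(l < m.+1) tau (k, val l) w | m in [set: nat]].

End oriented_swap_process.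

Section last_passage_percolation.
Variable R : realType.

(* x i j is the weight of the cell (i.+1, j.+1), so that lpp x i j is the last
   passage time L(i, j), with L(i, 0) = L(0, j) = 0. *)
Fixpoint lpp (x : nat -> nat -> R) (i : nat) : nat -> R :=
  if i is i'.+1 then
    fix row j := if j is j'.+1
                 then Num.max (lpp x i' j) (row j') + x i' j' else 0
  else fun=> 0.

Lemma lpp0j x j : lpp x 0 j = 0. Proof. by []. Qed.

Lemma lppi0 x i : lpp x i 0 = 0. Proof. by case: i. Qed.

Lemma lppSS x i j :
  lpp x i.+1 j.+1 = Num.max (lpp x i j.+1) (lpp x i.+1 j) + x i j.
Proof. by []. Qed.

Context d (T : measurableType d) (P : probability T R).
Context (n : nat) (X : nat * nat -> {RV P >-> R}).

Definition lpp_vector (w : T) : n.-1.-tuple R :=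
  [tuple lpp (fun i j => X (i, j) w) (n - k.+1) k.+1 | k < n.-1].

Lemma measurable_lpp i j :
  measurable_fun [set: T] (fun w => lpp (fun a b => X (a, b) w) i j).
Proof.
elim: i j => [|i IHi] j; first exact: measurable_cst.
elim: j => [|j IHj]; first exact: measurable_cst.
apply: measurable_realfun.measurable_funD; last exact: measurable_funPT.
by apply: measurable_realfun.measurable_maxr; [exact: IHi|exact: IHj].
Qed.

Lemma measurable_lpp_vector : measurable_fun [set: T] lpp_vector.
Proof.
apply/measurable_fun_tnthP => k.
rewrite (_ : _ \o _ =
  fun w => lpp (fun i j => X (i, j) w) (n - k.+1) k.+1); last first.
  by apply/funext => w /=; rewrite tnth_mktuple.
exact: measurable_lpp.
Qed.

HB.instance Definition _ :=
  isMeasurableFun.Build _ _ _ _ lpp_vector measurable_lpp_vector.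

End last_passage_percolation.

(* Main.v *)
(* Both vectors are functionals of a Markov chain driven by exponential clocks:
   permutations under adjacent sortings for the oriented swap process, and
   Young diagrams growing inside the staircase for last passage percolation.
   Each coordinate is the time at which some event, monotone along the chain,
   occurs, so by the memoryless property the Laplace transform with parameters
   xi, as a function of the initial state, satisfies a first-step equation:
   (number of running clocks + sum of the xi k over the pending events k) times
   the value at a state is the sum of the values at its successors.

   Write phi s and h l for these functions of a permutation s and of a diagram
   l.  They are related by a signed intertwining h l = sum_s N(l, s) phi s, in
   which the pending events of s are those of l whenever N(l, s) <> 0, so that N
   does not depend on xi.  For n <= 6 such an N is provided by flagged
   Jacobi-Trudi determinants, with rows indexed by those of l, in the elementary
   symmetric functions of the operators T_k - 1, where T_k is the generator of
   the 0-Hecke monoid acting at the positions k and k + 1; the intertwining is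
   checked by computation.  As N(empty diagram) is the identity permutation, the
   Laplace transforms of the two vectors coincide, hence so do their laws. *)

Require Import Defs.
From HB Require Import structures.
From mathcomp Require Import all_boot all_order all_algebra all_fingroup.
From mathcomp Require Import finmap.
From mathcomp Require Import all_classical all_reals all_analysis.
From mathcomp Require Import measurable_realfun.
From mathcomp Require Import zify ring lra.

Set Implicit Arguments.
Unset Strict Implicit.
Unset Printing Implicit Defensive.

Import Order.TTheory GRing.Theory Num.Theory.
Import numFieldNormedType.Exports.

Local Open Scope classical_set_scope.
Local Open Scope ring_scope.

(** * Races of exponential clocks *)

Definition std_exponential (R : realType) : probability (measurableTypeR R) R.
Proof. by refine (exponential_prob (1 : R)); exact: ltr01. Defined.

Arguments std_exponential : simpl never.

(** * Laplace transform, tails and memorylessness of the rate-1 exponential law *)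

Section exponential.
Context {R : realType}.
Local Open Scope ereal_scope.
Implicit Types (c m t : R) (h : measurableTypeR R -> \bar R).

Notation mu := (@lebesgue_measure R).
Notation E := (std_exponential R).

(** The Radon-Nikodym derivative of the law and the density have the same integral over every
    measurable set, hence agree almost everywhere. *)
Lemma integral_std_exponential h :
  measurable_fun setT h -> (forall x, 0 <= h x) ->
  \int[E]_x h x = \int[mu]_x (h x * (exponential_pdf (1 : R) x)%:E).
Proof.
move=> mh h0.
have dom : E `<< mu.
  apply/null_content_dominatesP => /= A mA A0.
  rewrite /exponential_prob; apply: null_set_integral => //.
  by apply/measurable_EFinP; apply: measurable_funTS; exact: measurable_exponential_pdf.
rewrite -(Radon_Nikodym_SigmaFinite.change_of_variables dom)//.
have mf : measurable_fun setT (Radon_Nikodym_SigmaFinite.f E mu).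
  by apply: (measurable_int mu); exact: Radon_Nikodym_SigmaFinite.f_integrable.
have mp : measurable_fun setT (EFin \o exponential_pdf (1 : R)).
  by apply/measurable_EFinP; exact: measurable_exponential_pdf.
apply: ae_eq_integral => //=.
- exact: emeasurable_funM.
- exact: emeasurable_funM.
have aeq : ae_eq mu setT (Radon_Nikodym_SigmaFinite.f E mu) (EFin \o exponential_pdf (1 : R)).
  apply: integral_ae_eq => //.
    exact: Radon_Nikodym_SigmaFinite.f_integrable.
  by move=> A _ mA; rewrite -Radon_Nikodym_SigmaFinite.f_integral.
by apply: filterS aeq => x /= fx Dx; rewrite fx.
Qed.

Lemma std_exponential_laplace c : (0 <= c)%R ->
  \int[E]_x (expR (- (c * x)))%:E = ((1 + c)^-1)%:E.
Proof.
move=> c0; have c1 : (0 < 1 + c)%R by rewrite ltr_wpDr.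
rewrite integral_std_exponential//; last first.
  apply/measurable_EFinP; apply: measurableT_comp => //.
  by apply: measurableT_comp => //; exact: measurable_funM.
(* Up to the factor [(1 + c)^-1], the integrand is the exponential density of rate [1 + c], of total
   mass 1. *)
under eq_integral => x _.
  rewrite -EFinM (_ : _ * _ = (1 + c)^-1 * exponential_pdf (1 + c) x)%R; last first.
    rewrite /exponential_pdf !patchE; case: ifPn => _; last by rewrite !mulr0.
    by rewrite mul1r mulrA mulVf ?gt_eqF// mul1r -expRD; congr expR; ring.
  rewrite EFinM; over.
rewrite ge0_integralZl ?integral_exponential_pdf ?mule1//.
- by apply/measurable_EFinP; exact: measurable_exponential_pdf.
- by move=> x _; rewrite lee_fin exponential_pdf_ge0// ltW.
- by rewrite lee_fin invr_ge0 ltW.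
Qed.

Lemma std_exponential_nonpos (A : set (measurableTypeR R)) :
  measurable A -> A `<=` `]-oo, 0%R] -> E A = 0.
Proof.
move=> mA A0; rewrite /std_exponential/= /exponential_prob.
transitivity (\int[mu]_(x in A) (cst 0 x)); last by rewrite integral0.
apply: ae_eq_integral => //.
  by apply/measurable_EFinP; apply: measurable_funTS; exact: measurable_exponential_pdf.
exists [set 0%R]; split => //; first exact: lebesgue_measure_set1.
move=> x /=; apply: contra_notP => /eqP x0 /A0; rewrite /= in_itv/= => xle.
by rewrite lt0_exponential_pdf// lt_neqAle x0.
Qed.

Lemma std_exponential_ray t : E `]t, +oo[%classic = (expR (- Num.max t 0))%:E.
Proof.
have /orP[t0|t0] := le_total t 0%R.
  rewrite max_r// oppr0 expR0 -[RHS](@probability_setT _ _ _ E).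
  rewrite -(setUv `]t, +oo[%classic) measureU// ?setICr//; last exact: measurableC.
  rewrite [X in _ + X]std_exponential_nonpos ?adde0//; first exact: measurableC.
  by rewrite setCitvr; apply: subset_itvl; rewrite bnd_simp.
rewrite max_l//.
have -> : `]t, +oo[%classic = ~` `]-oo, t]%classic by rewrite setCitvl.
rewrite probability_setC//.
have -> : `]-oo, t]%classic = `]-oo, 0%R[%classic `|` `[0%R, t]%classic.
  by rewrite -itv_bndbnd_setU// bnd_simp.
have -> : E (`]-oo, 0%R[ `|` `[0%R, t]) = E `[0%R, t]%classic.
  rewrite measureU//; last first.
    apply/seteqP; split => // x []/=; rewrite !in_itv/= => x0 /andP[].
    by rewrite leNgt x0.
  rewrite -[RHS]add0e; congr (_ + _); apply: std_exponential_nonpos => //.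
  by apply: subset_itvl; rewrite bnd_simp.
move: t0; rewrite le_eqVlt => /orP[/eqP<-|t0].
  rewrite oppr0 expR0 set_itv1 std_exponential_nonpos ?sube0//.
  by move=> x ->; rewrite /= in_itv/= lexx.
rewrite /= exponential_prob_itv0c// mulN1r.
by rewrite -!EFinB opprB addrC subrK.
Qed.

(** Open right rays form a pi-system that generates the Borel sets, and those starting at the
    negative integers exhaust the line. *)
Lemma measure_unique_rays (m1 m2 : {measure set (measurableTypeR R) -> \bar R}) :
  m1 setT < +oo -> (forall t, m1 `]t, +oo[%classic = m2 `]t, +oo[%classic) ->
  forall A, measurable A -> m1 A = m2 A.
Proof.
move=> m1oo m12 A mA.
pose g k : set (measurableTypeR R) := `](- k%:R)%R, +oo[%classic.
have Gm : @RGenOInfty.G R `<=` @measurable _ (measurableTypeR R).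
  by move=> _ [x ->]; exact: measurable_itv.
have Gg k : @RGenOInfty.G R (g k) by eexists; reflexivity.
have gT : \bigcup_k g k = setT.
  apply/seteqP; split => // x _; exists (Num.trunc `|x|).+1 => //=.
  rewrite /g /= in_itv/= andbT ltrNl.
  by rewrite (le_lt_trans _ (truncnS_gt _))// -normrN ler_norm.
have GI : setI_closed (@RGenOInfty.G R).
  move=> _ _ [x ->] [y ->]; exists (Num.max x y).
  by apply/seteqP; split => z /=; rewrite !in_itv/= !andbT gt_max => /andP.
have goo k : m1 (g k) < +oo by rewrite (le_lt_trans _ m1oo)// le_measure// inE//; exact: Gm.
have GE B : @RGenOInfty.G R B -> m1 B = m2 B by move=> [x ->].
have := @g_sigma_algebra_measure_unique _ R (measurableTypeR R) _ Gm g Gg gT m1 m2 GI GE goo.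
have <- : @measurable _ (measurableTypeR R) = <<s @RGenOInfty.G R >>.
  exact: RGenOInfty.measurableE.
exact.
Qed.

(** On the positive half-line, the image of the law under translation by [- m] is [expR (- m)] times
    the law, as both measures have the same mass on rays. The rest of the line is null for the
    law. *)
Lemma std_exponential_memoryless m h : (0 <= m)%R ->
  measurable_fun setT h -> (forall x, 0 <= h x) ->
  \int[E]_(x in `]m, +oo[) h (x - m)%R = (expR (- m))%:E * \int[E]_x h x.
Proof.
move=> m0 mh h0.
have ms : measurable_fun [set: measurableTypeR R]
  ((fun x => x - m)%R : _ -> measurableTypeR R) by exact: measurable_funB.
have em0 := expR_ge0 (- m).
have mpre (A : set (measurableTypeR R)) : measurable A ->
    measurable ((fun x : measurableTypeR R => x - m : measurableTypeR R)%R @^-1` A).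
  by move=> mA; rewrite -[X in measurable X]setTI; exact: ms.
have @rho : {measure set (measurableTypeR R) -> \bar R}.
  by refine (pushforward E (fun x : measurableTypeR R => x - m : measurableTypeR R)%R).
pose D : set (measurableTypeR R) := `]0%R, +oo[%classic.
have mD : measurable D by exact: measurable_itv.
have rhoE A : measurable A -> A `<=` D -> rho A = mscale (NngNum em0) E A.
  move=> mA AD.
  suff : mrestr rho mD A = mrestr (mscale (NngNum em0) E) mD A.
    by rewrite /mrestr setIidl.
  apply: measure_unique_rays => //.
    rewrite /= /mrestr /pushforward.
    apply: (@le_lt_trans _ _ 1); last by rewrite ltry.
    by apply: (probability_le1 E); apply: mpre; exact: measurableI.
  move=> t; rewrite /= /mrestr /D (_ : _ `&` _ = `](Num.max t 0)%R, +oo[%classic); last first.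
    by apply/seteqP; split => x /=; rewrite !in_itv/= !andbT gt_max => /andP.
  rewrite /rho /pushforward /mscale.
  rewrite (_ : _ @^-1` _ = `](m + Num.max t 0)%R, +oo[%classic); last first.
    by apply/seteqP; split => x /=; rewrite !in_itv/= !andbT ltrBrDl.
  rewrite -[LHS]/(E `](m + Num.max t 0)%R, +oo[%classic) !std_exponential_ray.
  rewrite -[X in _ = _ * X]/(E `](Num.max t 0)%R, +oo[%classic) std_exponential_ray.
  rewrite -EFinM/= -expRD -opprD; congr (expR (- _))%:E.
  have t0 : (0 <= Num.max t 0)%R by rewrite le_max lexx orbT.
  by rewrite [LHS]max_l ?addr_ge0// [in RHS]max_l.
transitivity (\int[rho]_(x in D) h x).
  rewrite /rho ge0_integral_pushforward//; last exact: measurable_funTS.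
  congr (integral _ _ _).
  by apply/seteqP; split => x; rewrite /D /= !in_itv/= !andbT subr_gt0.
rewrite (eq_measure_integral (mscale (NngNum em0) E)); last by move=> A mA AD; exact: rhoE.
rewrite ge0_integral_mscale//; last exact: measurable_funTS.
congr (_ * _).
rewrite -[in RHS](setUv D) ge0_integral_setU//=.
- rewrite [X in _ + X]null_set_integral ?adde0//.
  + exact: measurableC.
  + exact: measurable_funTS.
  + by rewrite [LHS]std_exponential_nonpos//; [exact: measurableC|rewrite setCitvr].
- exact: measurableC.
- by rewrite setUv.
- exact/disj_setPCl.
Qed.
End exponential.

(** * The product sigma-algebra on families of waiting times *)

Section configs.
Context {I : choiceType} {R : realType}.

Definition cylinder : set (set (I -> R)) :=
  [set A | exists (J : {fset I}) (B : I -> set R), (forall i, measurable (B i)) /\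
     A = \bigcap_(i in [set` J]) (fun v : I -> R => v i) @^-1` B i].

Definition configs := g_sigma_algebraType cylinder.

HB.instance Definition _ := Measurable.on configs.

Lemma measurable_coord i : measurable_fun [set: configs] (fun v : configs => v i).
Proof.
move=> _ A mA; rewrite setTI; apply: sub_sigma_algebra.
exists [fset i]%fset, (fun=> A); split=> //.
apply/seteqP; split => v /=.
  by move=> Avi j /=; rewrite inE => /eqP ->.
by move/(_ i); apply; rewrite /= inE.
Qed.

Lemma measurable_configsP d (T : measurableType d) (f : T -> configs) :
  (forall i, measurable_fun [set: T] (fun x => f x i)) -> measurable_fun [set: T] f.
Proof.
move=> mf; apply: (@measurability _ _ _ configs _ _ cylinder) => //.
move=> _ [_ [J [B [mB ->]]] <-]; rewrite setTI preimage_bigcap.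
apply: fin_bigcap_measurable => // i _.
by rewrite -[X in measurable X]setTI; exact: mf.
Qed.

Lemma cylinderI : setI_closed cylinder.
Proof.
move=> _ _ [J [B [mB ->]]] [J' [B' [mB' ->]]].
exists (J `|` J')%fset,
  (fun i => (if i \in J then B i else setT) `&` (if i \in J' then B' i else setT)).
split=> [i|].
  by apply: measurableI; case: ifP.
apply/seteqP; split => v /=.
  by move=> [vB vB'] i _ /=; split; case: ifP => // ?; [exact: vB|exact: vB'].
move=> vBB; split => i /= iJ; have := vBB i; rewrite /= inE iJ ?orbT => /(_ isT)[];
  by rewrite ?iJ.
Qed.

Lemma configs_measure_unique (m1 m2 : {measure set configs -> \bar R}) :
  (m1 setT < +oo)%E -> (forall A, cylinder A -> m1 A = m2 A) ->
  forall A, measurable A -> m1 A = m2 A.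
Proof.
move=> m1oo m12 A mA.
pose g (k : nat) : set configs := setT.
have Gm : cylinder `<=` @measurable _ configs by move=> B; exact: sub_sigma_algebra.
have Gg k : cylinder (g k).
  exists fset0, (fun=> setT); split => //.
  by apply/seteqP; split.
have gT : \bigcup_k g k = setT by rewrite bigcup_const//; exists 0%N.
have goo k : (m1 (g k) < +oo)%E by [].
have := @g_sigma_algebra_measure_unique _ R configs _ Gm g Gg gT m1 m2 cylinderI m12 goo.
exact.
Qed.

Definition upd (v : I -> R) (i : I) (x : R) : configs :=
  fun j => if j == i then x else v j.

(** The residual waiting times of the clocks in [J] at the moment when the clock [i] rings. *)
Definition sub_at (i : I) (J : seq I) (v : I -> R) : configs :=
  fun j => if j \in J then v j - v i else v j.

End configs.
Arguments configs : clear implicits.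

Lemma measurable_ltR d (T : measurableType d) (R : realType) (f g : T -> R) :
  measurable_fun setT f -> measurable_fun setT g ->
  measurable_fun setT (fun x => (f x < g x)%R%:R : R).
Proof.
move=> mf mg.
rewrite (_ : (fun _ => _) = fun x => if (f x < g x)%R then 1 else 0 : R).
  by apply: measurable_fun_ifT => //; exact: measurable_fun_ltr.
by apply/funext => x; case: ifP.
Qed.

(** * Independent clocks: which one rings first, and what remains of the others *)

Section race.
Context {I : choiceType} {R : realType} d {T : measurableType d} {P : probability T R}.
Variable X : I -> {RV P >-> R}.
Hypothesis iidX : iid_exponential X 1.
Local Open Scope ereal_scope.

Notation E := (std_exponential R).

Definition config_of (w : T) : configs I R := fun i => X i w.

Lemma measurable_config_of : measurable_fun setT config_of.
Proof. by apply: measurable_configsP => i; exact: measurable_funPT. Qed.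

Lemma iid_exponential_gt0 i : {ae P, forall w, (0 < X i w)%R}.
Proof.
exists (X i @^-1` `]-oo, 0%R]); split.
- by rewrite -[X in measurable X]setTI; exact: measurable_funPT.
- have := (proj2 iidX) i `]-oo, 0%R]%classic (measurable_itv _).
  rewrite /distribution /pushforward => ->.
  by apply: (@std_exponential_nonpos R).
- by move=> w /= /negP; rewrite in_itv/= -leNgt.
Qed.

Lemma iid_exponential_ge0 i : {ae P, forall w, (0 <= X i w)%R}.
Proof. by have := iid_exponential_gt0 i; apply: filterS => w; exact: ltW. Qed.

Lemma measurable_upd i :
  measurable_fun setT (fun z : T * measurableTypeR R => upd (config_of z.1) i z.2).
Proof.
apply: measurable_configsP => j; rewrite /upd; case: eqP => _; first exact: measurable_snd.
apply: (measurableT_comp (measurable_funPT (X j))); exact: measurable_fst.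
Qed.

(** By independence, replacing the coordinate [i] by a fresh exponential variable does not change
    the law of the family; it is enough to compare cylinders. *)
Lemma integral_freeze (F : configs I R -> \bar R) i :
  measurable_fun setT F -> (forall v, 0 <= F v) ->
  \int[P]_w F (config_of w) = \int[P]_w \int[E]_x F (upd (config_of w) i x).
Proof.
move=> mF F0.
pose phi (z : T * measurableTypeR R) := upd (config_of z.1) i z.2.
have mphi : measurable_fun setT phi := measurable_upd i.
have mX := measurable_config_of.
transitivity (\int[P \x E]_z F (phi z)); last first.
  rewrite (@fubini_tonelli1 _ _ _ _ _ P E (F \o phi))//.
    exact: measurableT_comp.
  by move=> x; exact: F0.
have @m1 : {measure set (configs I R) -> \bar R} by refine (pushforward P config_of).
have @m2 : {measure set (configs I R) -> \bar R} by refine (pushforward (P \x E) phi).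
transitivity (\int[m1]_v F v); first by rewrite /m1 ge0_integral_pushforward.
transitivity (\int[m2]_v F v); last by rewrite /m2 ge0_integral_pushforward.
apply: eq_measure_integral => A mA _.
apply: configs_measure_unique mA => {A}.
  by rewrite /= /pushforward preimage_setT probability_setT ltry.
move=> _ [J [B [mB ->]]]; rewrite /m1 /m2 /= /pushforward !preimage_bigcap.
have [ind law] := iidX.
rewrite [LHS]ind//.
(* The cylinder constrains the fresh coordinate only if [i] belongs to [J]. *)
pose B' := if i \in J then B i else setT.
have mB' : measurable B' by rewrite /B'; case: ifP.
rewrite (_ : \bigcap_(k in [set` J]) _ =
    (\bigcap_(k in [set` (J `\ i)%fset]) X k @^-1` B k) `*` B'); last first.
  apply/seteqP; split => -[w x] /=.
    move=> H; split.
      by move=> k /=; rewrite !inE => /andP[ki kJ]; have := H k kJ; rewrite /= /phi /upd (negPf ki).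
    by rewrite /B'; case: ifP => // /H; rewrite /= /phi /upd eqxx.
  move=> [Hw Hx] k /= kJ; rewrite /phi /upd; case: eqP => [ki|/eqP ki]/=.
    by move: Hx; rewrite /B' -ki kJ.
  by apply: Hw; rewrite /= !inE ki.
rewrite product_measure1E//; last first.
  apply: fin_bigcap_measurable => // k _.
  by rewrite -[X in measurable X]setTI; exact: measurable_funPT.
have indi := ind (J `\ i)%fset B (fun k _ => mB k).
rewrite -[X in _ = X * _]/(P (\bigcap_(k in [set` (J `\ i)%fset]) X k @^-1` B k)) indi.
rewrite -[X in _ = _ * X]/(E B') /B'; case: ifPn => iJ.
  rewrite (big_fsetD1 i)//= muleC; congr (_ * _).
  exact: law.
rewrite probability_setT mule1; congr (bigop _ _ _).
by rewrite mem_fsetD1.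
Qed.

(** Memorylessness, one clock of [J] at a time: for a fixed value of [X i], integrating over [X j]
    turns the condition [X i < X j] and the subtraction of [X i] into a factor [expR (- X i)]. *)
Lemma race_sub_at i (J : seq I) (F : configs I R -> \bar R) :
  uniq J -> i \notin J -> measurable_fun setT F -> (forall v, 0 <= F v) ->
  \int[P]_w ((all (fun j => X i w < X j w)%R J)%:R%:E * F (sub_at i J (config_of w)))
  = \int[P]_w ((expR (- ((size J)%:R * X i w)))%:E * F (config_of w)).
Proof.
have mc := @measurable_coord I R.
elim: J F => [|j J IH] F /=.
  move=> _ _ mF F0; apply: eq_integral => w _.
  by rewrite mul0r oppr0 expR0.
move=> /andP[jJ uJ]; rewrite inE negb_or => /andP[ij iJ] mF F0.
(* [F'] carries out the comparison and the subtraction for [j] alone, leaving those of the tail [J]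
   to the induction hypothesis. *)
pose F' (v : configs I R) := (v i < v j)%R%:R%:E * F (upd v j (v j - v i)).
have mF' : measurable_fun setT F'.
  apply: emeasurable_funM.
    by apply/measurable_EFinP; exact: measurable_ltR.
  apply: (measurableT_comp mF); apply: measurable_configsP => k.
  rewrite /upd; case: eqP => _; last exact: mc.
  exact: measurable_funB.
have F'0 v : 0 <= F' v by rewrite mule_ge0// lee_fin.
transitivity (\int[P]_w ((all (fun j => X i w < X j w)%R J)%:R%:E *
    F' (sub_at i J (config_of w)))).
  apply: eq_integral => w _.
  have si : sub_at i J (config_of w) i = X i w by rewrite /sub_at (negPf iJ).
  have sj : sub_at i J (config_of w) j = X j w by rewrite /sub_at (negPf jJ).
  rewrite /F' si sj.
  rewrite muleA -EFinM -natrM mulnb andbC; congr (_ * F _).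
  apply/funext => k; rewrite /upd /sub_at inE; case: eqP => [->//|/=].
  by [].
rewrite IH//.
pose G (v : configs I R) := (expR (- ((size J)%:R * v i)))%:E * F' v.
pose G2 (v : configs I R) := (expR (- ((size J).+1%:R * v i)))%:E * F v.
have mexp (c : R) : measurable_fun setT (fun v : configs I R => (expR (- (c * v i)))%:E).
  apply/measurable_EFinP; apply: measurableT_comp => //.
  by apply: measurableT_comp => //; exact: measurable_funM.
have mG : measurable_fun setT G by exact: emeasurable_funM.
have mG2 : measurable_fun setT G2 by exact: emeasurable_funM.
have G0 v : 0 <= G v by rewrite mule_ge0// lee_fin expR_ge0.
have G20 v : 0 <= G2 v by rewrite mule_ge0// lee_fin expR_ge0.
have int_meas (H : configs I R -> \bar R) : measurable_fun setT H -> (forall v, 0 <= H v) ->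
    measurable_fun setT (fun w => \int[E]_x H (upd (config_of w) j x)).
  move=> mH H0.
  by apply: (@measurable_fun_fubini_tonelli_F _ _ _ _ _ E
    (fun z : T * measurableTypeR R => H (upd (config_of z.1) j z.2))) => //;
    apply: (measurableT_comp mH); exact: measurable_upd.
rewrite [LHS](integral_freeze j mG)// [RHS](integral_freeze j mG2)//.
apply: ae_eq_integral => //; [exact: int_meas|exact: int_meas|].
have := iid_exponential_ge0 i; apply: filterS => w Xi0 _.
set m := X i w in Xi0 *.
have updi x : upd (config_of w) j x i = m by rewrite /upd (negPf ij).
pose h x := F (upd (config_of w) j x).
have mh : measurable_fun [set: measurableTypeR R] h.
  apply: (measurableT_comp mF); apply: measurable_configsP => k.
  by rewrite /upd; case: eqP.
transitivity (\int[E]_x ((expR (- ((size J)%:R * m)))%:E *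
    ((m < x)%R%:R%:E * h (x - m)%R))).
  apply: eq_integral => x _; rewrite /G /F' updi; congr (_ * (_ * F _)).
    by rewrite /upd eqxx.
  by apply/funext => k; rewrite /upd eqxx; case: eqP.
have mhm : measurable_fun [set: measurableTypeR R] (fun x : R => h (x - m)%R).
  by apply: (measurableT_comp mh); exact: measurable_funB.
rewrite ge0_integralZl//; last 2 first.
- apply: emeasurable_funM => //; apply/measurable_EFinP; exact: measurable_ltR.
- by move=> x _; rewrite mule_ge0//; exact: F0.
transitivity ((expR (- ((size J)%:R * m)))%:E * ((expR (- m))%:E * \int[E]_x h x)).
  congr (_ * _); rewrite -std_exponential_memoryless//; last by move=> x; exact: F0.
  rewrite [RHS]integral_mkcond; apply: eq_integral => x _; rewrite patchE.
  rewrite mem_setE in_itv/= andbT.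
  by case: (m < x)%R; rewrite ?mul1e ?mul0e.
rewrite muleA -EFinM -expRD.
transitivity (\int[E]_x ((expR (- ((size J).+1%:R * m)))%:E * h x)); last first.
  by apply: eq_integral => x _; rewrite /G2 updi.
rewrite ge0_integralZl//; last by move=> x _; exact: F0.
by congr ((expR _)%:E * _); rewrite -[(_.+1)%:R]natr1; ring.
Qed.

(** Once the other clocks are replaced by fresh ones, [X i] enters only through exponential factors,
    as [F] ignores the coordinate [i]; its Laplace transform at [size J + c] gives the constant. *)
Lemma integral_race i (J : seq I) (c : R) (F : configs I R -> \bar R) :
  uniq J -> i \notin J -> (0 <= c)%R ->
  measurable_fun setT F -> (forall v, 0 <= F v) ->
  (forall v x, F (upd v i x) = F v) ->
  \int[P]_w ((all (fun j => X i w < X j w)%R J)%:R%:E *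
    ((expR (- (c * X i w)))%:E * F (sub_at i J (config_of w)))) =
  (((size J).+1%:R + c)^-1)%:E * \int[P]_w F (config_of w).
Proof.
move=> uJ iJ c0 mF F0 Fi.
have mexp (a : R) : measurable_fun setT (fun v : configs I R => (expR (- (a * v i)))%:E).
  apply/measurable_EFinP; apply: measurableT_comp => //.
  apply: measurableT_comp => //; apply: measurable_funM => //; exact: measurable_coord.
pose F1 (v : configs I R) := (expR (- (c * v i)))%:E * F v.
have mF1 : measurable_fun setT F1 by exact: emeasurable_funM.
have F10 v : 0 <= F1 v by rewrite mule_ge0// lee_fin expR_ge0.
transitivity (\int[P]_w ((all (fun j => X i w < X j w)%R J)%:R%:E *
    F1 (sub_at i J (config_of w)))).
  by apply: eq_integral => w _; rewrite /F1 {2}/sub_at (negPf iJ).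
rewrite race_sub_at//.
pose G (v : configs I R) := (expR (- (((size J)%:R + c) * v i)))%:E * F v.
transitivity (\int[P]_w G (config_of w)).
  apply: eq_integral => w _; rewrite /F1 /G muleA -EFinM -expRD.
  by congr ((expR _)%:E * _); rewrite /config_of; ring.
have mG : measurable_fun setT G by exact: emeasurable_funM.
have G0 v : 0 <= G v by rewrite mule_ge0// lee_fin expR_ge0.
rewrite (integral_freeze i mG)//.
have sJc : (0 <= (size J)%:R + c)%R by rewrite addr_ge0.
rewrite -ge0_integralZl//; last 2 first.
- by apply: (measurableT_comp mF); exact: measurable_config_of.
- by rewrite lee_fin invr_ge0 addr_ge0.
apply: eq_integral => w _.
under eq_integral => x _ do rewrite /G Fi /upd eqxx.
rewrite ge0_integralZr//; last first.
  apply/measurable_EFinP; apply: measurableT_comp => //.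
  by apply: measurableT_comp => //; exact: measurable_funM.
rewrite std_exponential_laplace//; congr (_%:E * _).
by rewrite -[(_.+1)%:R]natr1; congr (_^-1)%R; ring.
Qed.

End race.

Lemma iid_exponential_inj (I J : choiceType) (R : realType) d (T : measurableType d)
    (P : probability T R) (X : I -> {RV P >-> R}) (rate : R) (f : J -> I) (g : I -> J) :
  cancel f g -> iid_exponential X rate -> iid_exponential (fun j => X (f j)) rate.
Proof.
move=> fK [ind law]; split=> [A B mB|j B mB]; last exact: law.
have indA := ind (f @` A)%fset (fun i => B (g i)).
rewrite (_ : \bigcap_(i in _) _ = \bigcap_(i in [set` (f @` A)%fset]) X i @^-1` B (g i)).
  rewrite indA.
    rewrite big_imfset/=; last by move=> x y _ _; exact: (can_inj fK).
    by apply: eq_bigr => j _; rewrite fK.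
  by move=> i /imfsetP[/= j jA ->]; rewrite fK; exact: mB.
apply/seteqP; split => w /=.
  by move=> H i /= /imfsetP[/= j jA ->]; rewrite fK; exact: H.
move=> H j /= jA; have := H (f j); rewrite /= fK; apply.
by apply/imfsetP; exists j.
Qed.

(** * Markov chains driven by clocks, and their first-step equations *)

Section race_system.
Context {K : choiceType} {R : realType} {S : Type}.
Variables (D : S -> seq K) (del : S -> K -> S) (final : pred S).
Hypothesis uniqD : forall s, uniq (D s).

(* D s lists the clocks that run in the state s, and del s i is the state reached
   when the clock i rings first.  The entry v (i, k) of a configuration is the
   k-th coming waiting time of the clock i; v (i, 0) is the current one, and it
   elapses only while the clock runs. *)
Definition shift_config (i : K) (v : K * nat -> R) : configs (K * nat)%type R :=
  fun p => if p.1 == i then v (i, p.2.+1) else v p.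

Definition next_config (i : K) (Ds : seq K) (v : K * nat -> R) : configs (K * nat)%type R :=
  shift_config i (sub_at (i, 0%N) [seq (j, 0%N) | j <- rem i Ds] v).

Definition first_ring (i : K) (Ds : seq K) (v : K * nat -> R) : bool :=
  all (fun j => v (i, 0%N) < v (j, 0%N)) (rem i Ds).

(* The exponential of minus the total cost of the run, when c s is the cost per unit
   of time of the state s; it is 0 if N rings do not lead to a final state, or if
   two clocks tie. *)
Fixpoint race_value (c : S -> R) (N : nat) (s : S) (v : K * nat -> R) : R :=
  if final s then 1 else
  if N is N'.+1 then
    \sum_(i <- D s) (first_ring i (D s) v)%:R * (expR (- (c s * v (i, 0%N))) *
       race_value c N' (del s i) (next_config i (D s) v))
  else 0.

(** The expectation of [race_value] for i.i.d. clocks of rate 1. *)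
Fixpoint race_laplace (c : S -> R) (N : nat) (s : S) : R :=
  if final s then 1 else
  if N is N'.+1 then
    ((size (D s))%:R + c s)^-1 * \sum_(i <- D s) race_laplace c N' (del s i)
  else 0.

Lemma race_valueE c N s v : race_value c N.+1 s v = if final s then 1 else
    \sum_(i <- D s) (first_ring i (D s) v)%:R * (expR (- (c s * v (i, 0%N))) *
       race_value c N (del s i) (next_config i (D s) v)).
Proof. by []. Qed.

Lemma race_laplaceE c N s : race_laplace c N.+1 s = if final s then 1 else
    ((size (D s))%:R + c s)^-1 * \sum_(i <- D s) race_laplace c N (del s i).
Proof. by []. Qed.

Lemma next_config_row i Ds v k : next_config i Ds v (i, k) = v (i, k.+1).
Proof.
rewrite /next_config /shift_config /= eqxx /sub_at.
by case: ifPn => // /mapP[? _ []].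
Qed.

Lemma next_config_other i Ds v a k : a != i -> (k != 0%N) || (a \notin Ds) ->
  next_config i Ds v (a, k) = v (a, k).
Proof.
move=> ai kD; rewrite /next_config /shift_config /= (negPf ai) /sub_at.
case: ifPn => // /mapP[b bD [ab k0]]; move: kD; rewrite k0/= ab.
by rewrite (mem_rem bD).
Qed.

Lemma next_config_racing i Ds v a : uniq Ds -> a != i -> a \in Ds ->
  next_config i Ds v (a, 0%N) = v (a, 0%N) - v (i, 0%N).
Proof.
move=> uD ai aD; rewrite /next_config /shift_config /= (negPf ai) /sub_at.
by rewrite map_f// mem_rem_uniq// inE ai.
Qed.

Lemma next_config_ge0 i Ds v : first_ring i Ds v -> (forall p, 0 <= v p) ->
  forall p, 0 <= next_config i Ds v p.
Proof.
move=> /allP fr v0 [a k]; rewrite /next_config /shift_config /= /sub_at.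
have sub p : 0 <= if p \in [seq (j, 0%N) | j <- rem i Ds] then v p - v (i, 0%N) else v p.
  by case: ifPn => // /mapP[b bD ->]; rewrite subr_ge0 ltW// fr.
by case: ifP => _; exact: sub.
Qed.

Lemma measurable_shift_config i : measurable_fun [set: configs (K * nat)%type R] (shift_config i).
Proof.
apply: measurable_configsP => p; rewrite /shift_config.
by case: eqP => _; exact: measurable_coord.
Qed.

Lemma measurable_next_config i Ds :
  measurable_fun [set: configs (K * nat)%type R] (next_config i Ds).
Proof.
apply: (measurableT_comp (measurable_shift_config i)).
apply: measurable_configsP => p; rewrite /sub_at.
case: (p \in [seq (j, 0%N) | j <- rem i Ds]); last exact: measurable_coord.
by apply: measurable_funB; exact: measurable_coord.
Qed.

Lemma measurable_first_ring i Ds :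
  measurable_fun [set: configs (K * nat)%type R] (fun v => (first_ring i Ds v)%:R : R).
Proof.
rewrite /first_ring; elim: (rem i Ds) => [|j J IH] /=; first exact: measurable_cst.
under eq_fun => v do rewrite -mulnb natrM.
by apply: measurable_funM => //; apply: measurable_ltR; exact: measurable_coord.
Qed.

Lemma measurable_race_value c N s :
  measurable_fun [set: configs (K * nat)%type R] (race_value c N s).
Proof.
elim: N s => [|N IH] s.
  by rewrite /race_value; case: (final s); exact: measurable_cst.
rewrite (_ : race_value _ _ _ = fun v => if final s then 1 else
    \sum_(i <- D s) (first_ring i (D s) v)%:R * (expR (- (c s * v (i, 0%N))) *
       race_value c N (del s i) (next_config i (D s) v)))//.
case: (final s); first exact: measurable_cst.
apply: measurable_sum => i.
apply: measurable_funM; first exact: measurable_first_ring.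
apply: measurable_funM; last by apply: measurableT_comp (IH _) (measurable_next_config _ _).
apply: measurableT_comp => //; apply: measurableT_comp => //.
by apply: measurable_funM => //; exact: measurable_coord.
Qed.

Lemma race_value_ge0 c N s v : 0 <= race_value c N s v.
Proof.
elim: N s v => [|N IH] s v /=; first by case: (final s).
case: (final s) => //; apply: sumr_ge0 => i _.
by rewrite mulr_ge0// mulr_ge0// expR_ge0.
Qed.

(** With zero cost this is the indicator that a final state is reached within [N] rings without
    ties: at most one clock strictly precedes all the others of [D s]. *)
Lemma race_value0_le1 N s v : race_value (fun=> 0) N s v <= 1.
Proof.
elim: N s v => [|N IH] s v /=; first by case: (final s).
case: (final s) => //.
have [[i iD fi]|nfi] := pselect (exists2 i, i \in D s & first_ring i (D s) v).
  rewrite (big_rem i)//= fi mul1r mul0r oppr0 expR0 mul1r big1_seq ?addr0// => j /andP[_].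
  rewrite mem_rem_uniq// inE => /andP[ji jD].
  rewrite (_ : first_ring j _ _ = false) ?mul0r//; apply/negbTE/negP => /allP fj.
  move/allP: fi => /(_ j); rewrite mem_rem_uniq// inE ji jD => /(_ isT) ij.
  have := fj i; rewrite mem_rem_uniq// inE eq_sym ji iD => /(_ isT).
  by rewrite ltNge (ltW ij).
rewrite big1_seq// => i /andP[_ iD].
rewrite (_ : first_ring i _ _ = false) ?mul0r//; apply/negbTE/negP => fi.
by apply: nfi; exists i.
Qed.

(** First-step analysis: by [integral_race], the configuration left after the first ring can be
    replaced by an i.i.d. one, so the induction hypothesis applies to each successor. *)
Lemma integral_race_value c N s d (T : measurableType d) (P : probability T R)
    (X : K * nat -> {RV P >-> R}) :
  (forall s, 0 <= c s) -> iid_exponential X 1 ->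
  (\int[P]_w (race_value c N s (config_of X w))%:E = (race_laplace c N s)%:E)%E.
Proof.
move=> c0; have cst1 (r : R) : (\int[P]_w r%:E = r%:E)%E.
  by rewrite integral_cst//= probability_setT mule1.
elim: N s X => [|N IH] s X iidX.
  by rewrite /race_value /race_laplace; case: (final s); rewrite cst1.
rewrite race_laplaceE; under eq_integral => w _ do rewrite race_valueE.
case: (final s); first by rewrite cst1.
have mX := measurable_config_of X.
have mv := measurable_race_value c N.
under eq_integral => w _ do rewrite -sumEFin.
rewrite ge0_integral_sum//; last 2 first.
- move=> i; apply/measurable_EFinP.
  apply: measurable_funM; first exact: measurableT_comp (measurable_first_ring _ _) mX.
  apply: measurable_funM.
    apply: measurableT_comp => //; apply: measurableT_comp => //.
    by apply: measurable_funM => //; exact: measurableT_comp (measurable_coord _) mX.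
  apply: measurableT_comp (mv _) _.
  exact: measurableT_comp (measurable_next_config _ _) mX.
- by move=> i w _; rewrite lee_fin mulr_ge0// mulr_ge0 ?expR_ge0// race_value_ge0.
rewrite mulr_sumr -sumEFin !big_seq; apply: eq_bigr => i iD.
(* Shifting the row of [i] drops the coordinate [(i, 0)], so that [F] does not depend on it, as
   [integral_race] requires. *)
pose F (v : configs (K * nat)%type R) : \bar R := (race_value c N (del s i) (shift_config i v))%:E.
have mF : measurable_fun setT F.
  apply/measurable_EFinP; apply: measurableT_comp (mv _) _.
  exact: measurable_shift_config.
have F0 v : (0 <= F v)%E by rewrite lee_fin race_value_ge0.
pose J := [seq (j, 0%N) | j <- rem i (D s)].
have uJ : uniq J by rewrite map_inj_uniq ?rem_uniq// => x y [].
have iJ : (i, 0%N) \notin J.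
  by apply/mapP => -[j]; rewrite mem_rem_uniq// => + [ij]; rewrite -ij !inE eqxx.
have Fi v x : F (upd v (i, 0%N) x) = F v.
  congr (race_value _ _ _ _)%:E; apply/funext => p; rewrite /shift_config /upd.
  case: (p.1 =P i) => [_|pi]; first by rewrite xpair_eqE andbF.
  by case: eqP => // pE; case: pi; rewrite pE.
transitivity (\int[P]_w (((all (fun j => X (i, 0%N) w < X j w) J)%:R)%:E *
    ((expR (- (c s * X (i, 0%N) w)))%:E * F (sub_at (i, 0%N) J (config_of X w)))))%E.
  apply: eq_integral => w _; rewrite -!EFinM /first_ring; congr (_%:R * _)%:E.
  by rewrite all_map.
rewrite integral_race//.
rewrite (_ : (size J).+1 = size (D s)); last first.
  by rewrite size_map size_rem// prednK//; case: (D s) iD.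
rewrite EFinM; congr (_ * _)%E.
(* The shift amounts to reindexing the family along the injection [f], which preserves the i.i.d.
   property. *)
pose f (p : K * nat) := if p.1 == i then (i, p.2.+1) else p.
pose g (p : K * nat) := if p.1 == i then (i, p.2.-1) else p.
have fK : cancel f g.
  move=> [k l]; rewrite /f /g /=; case: (eqVneq k i) => [->|ki] /=.
    by rewrite eqxx.
  by rewrite (negPf ki).
rewrite -(IH _ (fun p => X (f p))); last exact: iid_exponential_inj fK iidX.
apply: eq_integral => w _; congr (race_value _ _ _ _)%:E.
apply/funext => p; rewrite /shift_config /config_of /f.
by case: (p.1 =P i).
Qed.

Section coupling.
Variables (m : nat) (F : S -> pred 'I_m) (xi : 'I_m -> R).
Variable Rel : S -> (K * nat -> R) -> ('I_m -> R) -> Prop.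
Let c s := \sum_(k | ~~ F s k) xi k.
Hypothesis Rel_final : forall s v u, Rel s v u -> final s -> forall k, F s k.
Hypothesis Rel_step : forall s v u i, Rel s v u -> ~~ final s -> i \in D s ->
  first_ring i (D s) v ->
  [/\ Rel (del s i) (next_config i (D s) v) (fun k => u k - v (i, 0%N)),
      forall k, F s k -> F (del s i) k &
      forall k, ~~ F s k -> F (del s i) k -> u k = v (i, 0%N)].

(* If u k is the time at which the event F k occurs, then [\sum_k xi k * u k] is
   the total cost of the run. *)
Lemma race_value_coupling N s v u : Rel s v u ->
  race_value c N s v =
  race_value (fun=> 0) N s v * expR (- \sum_(k | ~~ F s k) xi k * u k).
Proof.
elim: N s v u => [|N IH] s v u Rsvu.
  rewrite /race_value; case: ifPn => sf; last by rewrite mul0r.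
  rewrite big1 ?oppr0 ?expR0 ?mulr1// => k.
  by rewrite (Rel_final Rsvu sf).
rewrite !race_valueE; case: ifPn => sf.
  rewrite big1 ?oppr0 ?expR0 ?mulr1// => k.
  by rewrite (Rel_final Rsvu sf).
rewrite mulr_suml !big_seq; apply: eq_bigr => i iD.
case fi : (first_ring i (D s) v); last by rewrite !mul0r.
have [Rn Fmono Fnew] := Rel_step Rsvu sf iD fi.
rewrite (IH _ _ _ Rn) !mul1r mul0r oppr0 expR0 mul1r mulrCA -expRD -opprD; congr (_ * expR (- _)).
rewrite /c mulr_suml.
(* The events pending in [s] either occur at this ring, at the time [v (i, 0)], or stay pending with
   their times counted from the ring. *)
rewrite (bigID (F (del s i))) [RHS](bigID (F (del s i)))/= -addrA; congr (_ + _).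
  by apply: eq_bigr => k /andP[kF kF']; rewrite Fnew.
rewrite [X in _ + X = _](eq_bigl (fun k => ~~ F s k && ~~ F (del s i) k)); last first.
  by move=> k /=; case: (boolP (F s k)) => //= /Fmono ->.
by rewrite -big_split/=; apply: eq_bigr => k _; ring.
Qed.

End coupling.

(** * Letting the number of rings tend to infinity *)

Section limit.
Variable c : S -> R.
Hypothesis c0 : forall s, 0 <= c s.

Lemma race_laplace_ge0 N s : 0 <= race_laplace c N s.
Proof.
elim: N s => [|N IH] s /=; first by case: (final s).
by case: (final s) => //; rewrite mulr_ge0 ?invr_ge0 ?addr_ge0// sumr_ge0.
Qed.

Lemma race_laplace_le1 N s : race_laplace c N s <= 1.
Proof.
elim: N s => [|N IH] s /=; first by case: (final s).
case: (final s) => //.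
have := addr_ge0 (ler0n R (size (D s))) (c0 s).
rewrite le_eqVlt => /predU1P[<-|D0]; first by rewrite invr0 mul0r.
rewrite ler_pdivrMl// mulr1 (@le_trans _ _ (size (D s))%:R)//; last by rewrite lerDl.
rewrite -[leRHS]mulr1 -sum1_size natr_sum mulr_suml.
by apply: ler_sum => i _; rewrite mul1r.
Qed.

Lemma race_laplace_nd s : nondecreasing_seq (race_laplace c ^~ s).
Proof.
apply/nondecreasing_seqP => N; elim: N s => [|N IH] s.
  by rewrite [leLHS]/race_laplace; case: ifPn => sf;
    rewrite ?race_laplace_ge0// race_laplaceE sf.
rewrite !race_laplaceE; case: ifP => // _.
by rewrite ler_wpM2l ?invr_ge0 ?addr_ge0// ler_sum.
Qed.

Definition race_limit s : R := limn (race_laplace c ^~ s).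

Lemma cvg_race_laplace s : race_laplace c N s @[N --> \oo] --> race_limit s.
Proof.
apply: nondecreasing_is_cvgn; first exact: race_laplace_nd.
by exists 1 => _ [N _ <-]; exact: race_laplace_le1.
Qed.

Lemma race_limit_final s : final s -> race_limit s = 1.
Proof.
move=> sf; apply/cvg_lim => //.
rewrite (_ : race_laplace c ^~ s = cst 1); first exact: cvg_cst.
by apply/funext => -[|N] /=; rewrite sf.
Qed.

Lemma race_limit_step s : ~~ final s -> D s != [::] ->
  ((size (D s))%:R + c s) * race_limit s = \sum_(i <- D s) race_limit (del s i).
Proof.
move=> sf Ds.
have D0 : 0 < (size (D s))%:R + c s by rewrite ltr_pwDl// ltr0n lt0n size_eq0.
apply: (mulfI (invr_neq0 (lt0r_neq0 D0))).
rewrite mulKf ?gt_eqF//; apply/cvg_lim => //.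
rewrite -(cvg_shiftS (race_laplace c ^~ s)).
rewrite (_ : (fun n => _) = fun N =>
    ((size (D s))%:R + c s)^-1 * \sum_(i <- D s) race_laplace c N (del s i)); last first.
  by apply/funext => N; rewrite race_laplaceE (negPf sf).
apply: cvgM; first exact: cvg_cst.
elim: (D s) => [|i l IH].
  under eq_fun => N do rewrite big_nil.
  by rewrite big_nil; exact: cvg_cst.
under eq_fun => N do rewrite big_cons.
by rewrite big_cons; apply: cvgD => //; exact: cvg_race_laplace.
Qed.

End limit.

(** At cost 0 the limit is the probability of absorption. A successor is either [s] itself or has a
    smaller measure, hence the value 1 by induction; by the first-step equation the value [p] at [s]
    is then an average of copies of [p] and of at least one 1. *)
Lemma race_limit0 (Q : S -> Prop) (mu : S -> nat) :
  (forall s i, Q s -> i \in D s -> Q (del s i)) ->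
  (forall s i, Q s -> ~~ final s -> i \in D s -> del s i = s \/ (mu (del s i) < mu s)%N) ->
  (forall s, Q s -> ~~ final s -> exists2 i, i \in D s & (mu (del s i) < mu s)%N) ->
  forall s, Q s -> race_limit (fun=> 0) s = 1.
Proof.
move=> Qdel mono ex s; have [n] := ubnP (mu s); elim: n s => // n IH s mus Qs.
case: (boolP (final s)) => [sf|sf]; first exact: race_limit_final.
have [i0 i0D i0lt] := ex s Qs sf.
have Ds : D s != [::] by apply/eqP => D0; rewrite D0 in i0D.
have := @race_limit_step (fun=> 0) (fun=> lexx _) s sf Ds.
set p := race_limit _ s; rewrite addr0 => step.
have p1 : p <= 1.
  apply: limr_le; first by apply/cvg_ex; exists p; exact: cvg_race_laplace.
  by apply: nearW => N; exact: race_laplace_le1.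
have lt1 i : i \in D s -> (mu (del s i) < mu s)%N -> race_limit (fun=> 0) (del s i) = 1.
  move=> iD ilt; apply: IH; last exact: Qdel.
  by rewrite (leq_trans ilt).
apply/eqP; rewrite eq_le p1 /= -subr_le0.
have : \sum_(i <- D s) (race_limit (fun=> 0) (del s i) - p) = 0.
  by rewrite sumrB -step big_const_seq count_predT iter_addr_0 mulr_natl subrr.
rewrite (big_rem i0)//= lt1// => sum0; rewrite -sum0 lerDl big_seq sumr_ge0// => i.
rewrite mem_rem_uniq// inE => /andP[_ iD].
have [->|ilt] := mono s i Qs sf iD; first by rewrite subrr.
by rewrite lt1// subr_ge0.
Qed.

(** Here [e] stands for the exponential of minus the total cost; almost surely it agrees with
    [race_value c N] when absorption takes at most [N] rings. Its integral thus lies between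
    [race_laplace c N s] and the same plus the probability of no absorption, which tends to 0. *)
Lemma integral_race_limit c s d (T : measurableType d) (P : probability T R)
    (X : K * nat -> {RV P >-> R}) (e : T -> R) :
  (forall s, 0 <= c s) -> iid_exponential X 1 -> race_limit (fun=> 0) s = 1 ->
  measurable_fun setT e -> (forall w, 0 <= e w) ->
  {ae P, forall w, e w <= 1 /\ forall N, race_value c N s (config_of X w) =
     race_value (fun=> 0) N s (config_of X w) * e w} ->
  (\int[P]_w (e w)%:E = (race_limit c s)%:E)%E.
Proof.
move=> c0 iidX lim1 me e0 ae_e.
have mX := measurable_config_of X.
have mv c' N : measurable_fun setT (fun w => (race_value c' N s (config_of X w))%:E).
  by apply/measurable_EFinP; exact: measurableT_comp (measurable_race_value _ _ _) mX.
have c00 : forall s : S, (0 : R) <= (fun=> 0) s by [].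
have rv01 N w : 0 <= 1 - race_value (fun=> 0) N s (config_of X w).
  by rewrite subr_ge0 race_value0_le1.
have mr N : measurable_fun setT (fun w => (1 - race_value (fun=> 0) N s (config_of X w))%:E).
  by apply/measurable_EFinP; apply: measurable_funB => //; apply/measurable_EFinP; exact: mv.
have iE N : (\int[P]_w (1 - race_value (fun=> 0) N s (config_of X w))%:E =
    (1 - race_laplace (fun=> 0) N s)%:E)%E.
  have := integral_race_value N s c00 iidX.
  set a := (\int[P]_w _)%E; set b := race_laplace _ N s => aE.
  have : (\int[P]_w (1 - race_value (fun=> 0) N s (config_of X w))%:E + b%:E = 1)%E.
    rewrite -aE -ge0_integralD//; last 2 first.
    - by move=> w _; rewrite lee_fin.
    - by move=> w _; rewrite lee_fin race_value_ge0.
    under eq_integral => w _ do rewrite -EFinD subrK.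
    by rewrite integral_cst//= mul1e probability_setT.
  by move=> H; rewrite EFinB -H addeK.
set I := (\int[P]_w (e w)%:E)%E.
have mE : measurable_fun setT (fun w => (e w)%:E) by exact/measurable_EFinP.
have lo N : ((race_laplace c N s)%:E <= I)%E.
  rewrite -(integral_race_value N s c0 iidX); apply: ae_ge0_le_integral => //.
  - by move=> w _; rewrite lee_fin race_value_ge0.
  - by move=> w _; rewrite lee_fin.
  apply: filterS ae_e => w [_ eN] _; rewrite lee_fin eN ler_piMl//.
  exact: race_value0_le1.
have hi N : (I <= (race_laplace c N s + (1 - race_laplace (fun=> 0) N s))%:E)%E.
  rewrite EFinD -(integral_race_value N s c0 iidX) -iE -ge0_integralD//; last 2 first.
  - by move=> w _; rewrite lee_fin race_value_ge0.
  - by move=> w _; rewrite lee_fin.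
  apply: ae_ge0_le_integral => //.
  - by move=> w _; rewrite lee_fin.
  - by move=> w _; rewrite -EFinD lee_fin addr_ge0// race_value_ge0.
  - exact: emeasurable_funD.
  apply: filterS ae_e => w [e1 eN] _; rewrite -EFinD lee_fin eN -lerBlDl.
  rewrite -{1}[e w]mul1r -mulrBl ler_piMr//.
have Ifin : I \is a fin_num.
  rewrite ge0_fin_numE; last by apply: integral_ge0 => w _; rewrite lee_fin.
  by rewrite (le_lt_trans (hi 0%N))// ltry.
rewrite -(fineK Ifin); congr EFin; apply/eqP; rewrite eq_le; apply/andP; split.
  have cvgr : race_laplace c N s + (1 - race_laplace (fun=> 0) N s) @[N --> \oo] --> race_limit c s.
    have -> : race_limit c s = race_limit c s + (1 - race_limit (fun=> 0) s).
      by rewrite lim1 subrr addr0.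
    by apply: cvgD; [|apply: cvgB; [exact: cvg_cst|]]; exact: cvg_race_laplace.
  apply: (cvgr_to_ge cvgr); apply: nearW => N.
  by have := hi N; rewrite -{1}(fineK Ifin) lee_fin.
apply: (cvgr_to_le (cvg_race_laplace c0 (s := s))).
by apply: nearW => N; have := lo N; rewrite -{1}(fineK Ifin) lee_fin.
Qed.

End race_system.

(** * Uniqueness of Laplace transforms *)

(** Bernoulli's inequality, for the points beyond the threshold in [cvg_gumbel]. *)
Lemma expr1B_ge1BM (R : realDomainType) (z : R) n : 0 <= z <= 1 ->
  1 - n%:R * z <= (1 - z) ^+ n.
Proof.
move=> /andP[z0 z1]; elim: n => [|n IH]; first by rewrite mul0r subr0 expr0.
have y0 : 0 <= 1 - z by rewrite subr_ge0.
rewrite exprS (le_trans _ (ler_wpM2l y0 IH))// -subr_ge0 -natr1.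
rewrite (_ : _ - _ = n%:R * z ^+ 2); last by ring.
by rewrite mulr_ge0// sqr_ge0.
Qed.

Section cvg_indicator.
Variable R : realType.
Implicit Types t x : R.

(* The exponent is of order [N * exp (N t)], with [N = n.+1]: it makes the power
   below converge to the indicator of ]t, +oo[, also at the point t. *)
Definition gumbel_exponent t n : nat := (Num.trunc (n.+1%:R * expR (n.+1%:R * t))).+1.

(** Write [N = n.+1], [z = expR (- (N * x))] and [M] for the exponent. If [x <= t], then
    [M * z >= N] and the power is at most [expR (- (M * z))]. If [t < x], then [M * z] tends to 0
    and the power is at least [1 - M * z]. *)
Lemma cvg_gumbel t x : 0 <= t -> 0 <= x ->
  (1 - expR (- (n.+1%:R * x))) ^+ gumbel_exponent t n @[n --> \oo] --> ((t < x)%R%:R : R).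
Proof.
move=> t0 x0.
pose z n := expR (- (n.+1%:R * x)).
have z01 n : 0 <= z n <= 1.
  by rewrite expR_ge0/= expR_le1 oppr_le0 mulr_ge0.
have M0 n : 0 <= n.+1%:R * expR (n.+1%:R * t) by rewrite mulr_ge0 ?expR_ge0.
have [tx|xt] := ltP t x; last first.
  apply: (@squeeze_cvgr _ _ _ _ (cst 0) harmonic); [|exact: cvg_cst|exact: cvg_harmonic].
  apply: nearW => n; have /andP[z0 z1] := z01 n.
  rewrite exprn_ge0 ?subr_ge0//=.
  apply: (@le_trans _ _ (expR (- n.+1%:R))); last first.
    rewrite expRN /harmonic lef_pV2 ?posrE ?expR_gt0//.
    by rewrite (le_trans _ (expR_ge1Dx _))// lerDr.
  apply: (@le_trans _ _ (expR (- z n) ^+ gumbel_exponent t n)).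
    by rewrite lerXn2r ?nnegrE ?subr_ge0 ?expR_ge0// expR_ge1Dx.
  rewrite -expRM_natl ler_expR mulrN lerN2.
  apply: (@le_trans _ _ (n.+1%:R * expR (n.+1%:R * t) * z n)).
    rewrite -mulrA -expRD ler_peMr// -expR0 ler_expR -mulrBr mulr_ge0// subr_ge0//.
  by rewrite ler_wpM2r// ltW// truncnS_gt.
pose d := x - t; have d0 : 0 < d by rewrite subr_gt0.
(* The exponent times [z n] is bounded by two terms, each at most [2 / d ^+ 2 * harmonic n] because
   [expR y >= y ^+ 2 / 2]; hence the 4. *)
apply: (@squeeze_cvgr _ _ _ _ (fun n => 1 - (4 / d ^+ 2) * harmonic n) (cst 1)); last 2 first.
- rewrite -[X in _ --> X]subr0 -(mulr0 (4 / d ^+ 2)).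
  apply: cvgB; first exact: cvg_cst.
  by apply: cvgM; [exact: cvg_cst|exact: cvg_harmonic].
- exact: cvg_cst.
apply: nearW => n; have /andP[z0 z1] := z01 n.
apply/andP; split; last by rewrite exprn_ile1 ?subr_ge0// lerBlDr lerDl.
rewrite (le_trans _ (expr1B_ge1BM _ (z01 n)))// lerD2l lerN2.
have n0 : 0 < n.+1%:R :> R by rewrite ltr0n.
have zd : z n <= expR (- (n.+1%:R * d)).
  by rewrite ler_expR lerN2 ler_pM2l// lerBlDr lerDl.
have hd : n.+1%:R * expR (- (n.+1%:R * d)) <= 2 / d ^+ 2 * harmonic n.
  rewrite expRN ler_pdivrMr ?expR_gt0//.
  have nd : 0 <= n.+1%:R * d by rewrite mulr_ge0// ltW.
  have h := expR_ge1Dxn 1 nd.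
  have dn : 0 < 2 / d ^+ 2 * harmonic n.
    by rewrite mulr_gt0 ?divr_gt0 ?exprn_gt0// invr_gt0.
  apply: (@le_trans _ _ (2 / d ^+ 2 * harmonic n * ((n.+1%:R * d) ^+ 2 / 2))).
    rewrite /harmonic/=; move: n0; set N := n.+1%:R => n0.
    rewrite (_ : _ / _ * _ * _ = N)//.
    by field; rewrite !gt_eqF.
  rewrite ler_pM2l// (le_trans _ h)// (_ : 2`!%:R = 2)//.
  by rewrite lerDr.
apply: (@le_trans _ _ ((n.+1%:R * expR (n.+1%:R * t) + 1) * z n)).
  rewrite ler_wpM2r// /gumbel_exponent -natr1 lerD2r.
  by rewrite truncn_le.
rewrite mulrDl mul1r (_ : 4 / _ * _ = 2 / d ^+ 2 * harmonic n + 2 / d ^+ 2 * harmonic n); last by ring.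
apply: lerD.
  rewrite -mulrA -expRD (_ : _ - _ = - (n.+1%:R * d)) ?hd//; rewrite /d; ring.
rewrite (le_trans zd)// (le_trans _ hd)// ler_peMl ?expR_ge0//.
by rewrite ler1n.
Qed.

End cvg_indicator.

Lemma cvg_prod_seq (R : realType) (I : Type) (r : seq I) (f : nat -> I -> R) (l : I -> R) :
  (forall i, f n i @[n --> \oo] --> l i) ->
  \prod_(i <- r) f n i @[n --> \oo] --> \prod_(i <- r) l i.
Proof.
move=> fl; elim: r => [|i r IH].
  by under eq_fun => n do rewrite big_nil; rewrite big_nil; exact: cvg_cst.
by under eq_fun => n do rewrite big_cons; rewrite big_cons; exact: cvgM.
Qed.

Section laplace_unique.
Context {R : realType} {m : nat}.
Variables (mu1 mu2 : probability (m.-tuple R) R).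
Local Open Scope ereal_scope.

Let D : set (m.-tuple R) := [set u | forall k, (0 <= tnth u k)%R].

Hypothesis mu1D : mu1 (~` D) = 0.
Hypothesis mu2D : mu2 (~` D) = 0.
Hypothesis laplace : forall xi : 'I_m -> R, (forall k, (0 <= xi k)%R) ->
  \int[mu1]_(u in D) (expR (- \sum_k xi k * tnth u k))%:E =
  \int[mu2]_(u in D) (expR (- \sum_k xi k * tnth u k))%:E.

Let mD : measurable D.
Proof.
rewrite (_ : D = \bigcap_(k in [set: 'I_m]) (fun u => tnth u k) @^-1` `[0%R, +oo[).
  apply: fin_bigcap_measurable => // k _.
  by rewrite -[X in measurable X]setTI; exact: measurable_tnth.
by apply/seteqP; split => u /= Du k /=; have := Du k; rewrite /= in_itv/= andbT//; apply.
Qed.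

Let mlap (xi : 'I_m -> R) : measurable_fun D (fun u => expR (- \sum_k xi k * tnth u k)).
Proof.
apply: measurable_funTS; apply: measurableT_comp => //; apply: measurableT_comp => //.
by apply: measurable_sum => k; apply: measurable_funM => //; exact: measurable_tnth.
Qed.

Let ilap (mu : probability (m.-tuple R) R) (xi : 'I_m -> R) : (forall k, (0 <= xi k)%R) ->
  mu.-integrable D (fun u => (expR (- \sum_k xi k * tnth u k))%:E).
Proof.
move=> xi0; apply: measurable_bounded_integrable => //.
  by rewrite (le_lt_trans (probability_le1 _ _))// ltry.
exists 1%R; split => // M M1 u Du /=.
rewrite ger0_norm ?expR_ge0// (le_trans _ (ltW M1))// expR_le1 oppr_le0.
by apply: sumr_ge0 => k _; rewrite mulr_ge0.
Qed.

(** Multiplied out, the integrand is a linear combination of Laplace kernels whose parameters are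
    [n] times natural numbers, where the two transforms agree. *)
Lemma integral_prod_horner (p : 'I_m -> {poly R}) n :
  \int[mu1]_(u in D) (\prod_k (p k).[expR (- (n%:R * tnth u k))])%:E =
  \int[mu2]_(u in D) (\prod_k (p k).[expR (- (n%:R * tnth u k))])%:E.
Proof.
pose A := \max_k size (p k).
pose xi (f : {ffun 'I_m -> 'I_A}) k : R := (n%:R * (f k)%:R)%R.
pose a (f : {ffun 'I_m -> 'I_A}) : R := (\prod_k (p k)`_(f k))%R.
have expand u : (\prod_k (p k).[expR (- (n%:R * tnth u k))])%:E =
    \sum_(f : {ffun 'I_m -> 'I_A}) (a f)%:E * (expR (- \sum_k xi f k * tnth u k))%:E.
  rewrite (eq_bigr (fun k => \sum_(i < A) (p k)`_i * expR (- (n%:R * tnth u k)) ^+ i)%R); last first.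
    move=> k _; rewrite (@horner_coef_wide _ A)//.
    exact: (leq_bigmax (F := fun k => size (p k))).
  rewrite bigA_distr_bigA/= -sumEFin; apply: eq_bigr => f _.
  rewrite -EFinM big_split/=; congr (_ * _)%:E.
  rewrite -sumrN expR_sum; apply: eq_bigr => k _.
  by rewrite -expRM_natl; congr expR; rewrite /xi; ring.
have lin (mu : probability (m.-tuple R) R) :
    \int[mu]_(u in D) (\prod_k (p k).[expR (- (n%:R * tnth u k))])%:E =
    \sum_(f : {ffun 'I_m -> 'I_A}) (a f)%:E *
      \int[mu]_(u in D) (expR (- \sum_k xi f k * tnth u k))%:E.
  under eq_integral => u _ do rewrite expand.
  have xi0 f k : (0 <= xi f k)%R by rewrite mulr_ge0.
  rewrite integral_sum//; last by move=> f; apply: integrableZl => //; exact: ilap.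
  by apply: eq_bigr => f _; rewrite integralZl//; exact: ilap.
rewrite !lin; apply: eq_bigr => f _; congr (_ * _).
by apply: laplace => k; rewrite mulr_ge0.
Qed.

(** Only the coordinates selected by [b] are constrained, so that the whole space is an orthant and
    orthants are stable under intersection. *)
Definition orthant (b : 'I_m -> bool) (t : 'I_m -> R) : set (m.-tuple R) :=
  [set u | forall k, b k -> (t k < tnth u k)%R].

Lemma measurable_orthant b t : measurable (orthant b t).
Proof.
rewrite (_ : orthant b t = \bigcap_(k in [set k | b k])
    (fun u => tnth u k) @^-1` `](t k), +oo[).
  apply: fin_bigcap_measurable => // k _.
  by rewrite -[X in measurable X]setTI; exact: measurable_tnth.
by apply/seteqP; split => u /= Du k /= bk; have := Du k bk; rewrite /= in_itv/= andbT.
Qed.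

(** On [D] the indicator of the orthant is a bounded pointwise limit of products of polynomials in
    the variables [expR (- (n.+1%:R * tnth u k))], whose integrals agree; dominated convergence
    concludes. *)
Lemma orthant_nonneg_unique (b : 'I_m -> bool) (t : 'I_m -> R) : (forall k, b k -> (0 <= t k)%R) ->
  mu1 (orthant b t `&` D) = mu2 (orthant b t `&` D).
Proof.
move=> t0.
pose p n k : {poly R} := (if b k then (1 - 'X) ^+ gumbel_exponent (t k) n else 1)%R.
pose f n (u : m.-tuple R) : \bar R := (\prod_k (p n k).[expR (- (n.+1%:R * tnth u k))])%:E.
pose g (u : m.-tuple R) : \bar R := (\1_(orthant b t) u)%:E.
have fE n u : f n u = (\prod_k (if b k then
    (1 - expR (- (n.+1%:R * tnth u k))) ^+ gumbel_exponent (t k) n else 1))%:E.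
  congr EFin; apply: eq_bigr => k _; rewrite /p; case: (b k); last by rewrite hornerC.
  by rewrite !hornerE.
have mf n : measurable_fun D (f n).
  apply/measurable_EFinP; apply: measurable_funTS.
  rewrite (_ : (fun _ => _) = fun u : m.-tuple R => fine (f n u))//.
  under eq_fun => u do rewrite fE.
  apply: measurable_prod => k _; case: (b k); last exact: measurable_cst.
  apply: measurable_funX; apply: measurable_funB => //; apply: measurableT_comp => //.
  apply: measurableT_comp => //; apply: measurable_funM => //; exact: measurable_tnth.
have mg : measurable_fun D g.
  apply: measurable_funTS; apply/measurable_EFinP/measurable_indic; exact: measurable_orthant.
have cvgf u : D u -> f ^~ u @ \oo --> g u.
  move=> Du; under eq_fun => n do rewrite fE.
  apply: cvg_EFin; first exact: nearW.
  rewrite (_ : \1_ _ u = \prod_k (if b k then (t k < tnth u k)%R%:R else 1))%R; last first.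
    rewrite indicE; have [uO|uO] := boolP (u \in orthant b t).
      rewrite big1// => k _; case: ifPn => // bk.
      by move: uO; rewrite inE => /(_ k bk) ->.
    have /existsNP[k /not_implyP[bk /negP tk]] : ~ orthant b t u.
      by move=> h; move/negP: uO; apply; rewrite inE.
    by rewrite (bigD1 k)//= bk (negPf tk) mul0r.
  apply: (@cvg_prod_seq _ _ _ (fun n k => if b k then
    (1 - expR (- (n.+1%:R * tnth u k))) ^+ gumbel_exponent (t k) n else 1)%R) => k.
  case: ifPn => bk; last exact: cvg_cst.
  by apply: cvg_gumbel; [exact: t0|exact: Du].
have f01 n u : D u -> `|f n u| <= 1.
  move=> Du; rewrite fE abse_EFin lee_fin normr_prod.
  apply: prodr_ile1 => k _; rewrite normr_ge0/=; case: ifP => _; last by rewrite normr1.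
  have z01 : (0 <= expR (- (n.+1%:R * tnth u k)) <= 1)%R.
    by rewrite expR_ge0 expR_le1 oppr_le0 mulr_ge0//; exact: Du.
  have /andP[z0 z1] := z01.
  by rewrite ger0_norm ?exprn_ge0 ?exprn_ile1 ?subr_ge0// lerBlDr lerDl.
have conv (mu : probability (m.-tuple R) R) :
    \int[mu]_(u in D) f n u @[n --> \oo] --> mu (orthant b t `&` D).
  rewrite -(integral_indic _ mD (measurable_orthant b t)).
  have [] := @dominated_convergence _ _ _ mu D mD f g (cst 1) mf mg _ _ _ => //.
  - by apply: aeW => u Du; exact: cvgf.
  - apply: (@measurable_bounded_integrable _ _ _ mu) => //.
      by rewrite (le_lt_trans (probability_le1 _ _))// ltry.
    by exists 1%R; split => // M M1 u _ /=; rewrite normr1 ltW.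
  - by apply: aeW => u n Du; exact: f01.
have c2 := conv mu2; have c1 := conv mu1.
rewrite (_ : (fun n => \int[mu2]_(u in D) f n u) = fun n => \int[mu1]_(u in D) f n u) in c2.
  exact: cvg_unique c1 c2.
by apply/funext => n; rewrite /f integral_prod_horner.
Qed.

Lemma laplace_unique A : measurable A -> mu1 A = mu2 A.
Proof.
pose G : set (set (m.-tuple R)) := [set A | exists b t, A = orthant b t].
have Gm : G `<=` measurable by move=> _ [b [t ->]]; exact: measurable_orthant.
pose g (k : nat) : set (m.-tuple R) := setT.
have orT : orthant xpred0 (fun=> 0%R) = setT by apply/seteqP; split => // u _ k.
have Gg k : G (g k) by exists xpred0, (fun=> 0%R); rewrite orT.
have gT : \bigcup_k g k = setT by rewrite bigcup_const//; exists 0%N.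
have goo k : mu1 (g k) < +oo by rewrite /g probability_setT ltry.
have GI : setI_closed G.
  move=> _ _ [b1 [t1 ->]] [b2 [t2 ->]].
  exists (fun k => b1 k || b2 k), (fun k => if b1 k then
    if b2 k then Num.max (t1 k) (t2 k) else t1 k else t2 k).
  apply/seteqP; split => u.
    move=> [u1 u2] k; have := u1 k; have := u2 k.
    case: (b1 k) => /=; last by move=> h _ /h.
    case: (b2 k) => /=; last by move=> _ h /h.
    by move=> h2 h1 _; rewrite gt_max h1 ?h2.
  move=> h; split => k bk; have := h k; rewrite bk ?orbT => /(_ isT).
    by case: (b2 k) => //; rewrite gt_max => /andP[].
  by case: (b1 k) => //; rewrite gt_max => /andP[].
have G12 B : G B -> mu1 B = mu2 B.
  move=> [b [t ->]].
  have mo := measurable_orthant b t.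
  have split_D (mu : probability (m.-tuple R) R) : mu (~` D) = 0 ->
      mu (orthant b t) = mu (orthant (fun k => b k && (0 <= t k)%R) t `&` D).
    move=> muD; rewrite -{1}[orthant b t]setIT -(setUv D) setIUr measureU//.
    - rewrite [X in _ + X](@subset_measure0 _ _ _ _ _ (~` D)) ?adde0//.
      + congr (mu _); apply/seteqP; split => u [h Du]; split => // k.
          by move=> /andP[bk _]; exact: h.
        move=> bk; have [tk|tk] := leP 0%R (t k); first by apply: h; rewrite bk.
        exact: lt_le_trans (Du k).
      + by apply: measurableI => //; exact: measurableC.
      + exact: measurableC.
    - exact: measurableI.
    - by apply: measurableI => //; exact: measurableC.
    - by rewrite setIACA setICr setI0.
  rewrite !split_D//; apply: orthant_nonneg_unique => k /andP[] //.
move=> mA.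
have := @g_sigma_algebra_measure_unique _ R (m.-tuple R) _ Gm g Gg gT mu1 mu2 GI G12 goo.
apply.
(* The coordinates are measurable for the sigma-algebra generated by [G], so every measurable set of
   tuples belongs to it. *)
have idm : measurable_fun [set: g_sigma_algebraType G] (id : g_sigma_algebraType G -> m.-tuple R).
  apply/measurable_fun_tnthP => i.
  apply: (@measurability _ _ (g_sigma_algebraType G) R _ _ (@RGenOInfty.G R)).
    exact: RGenOInfty.measurableE.
  move=> _ [_ [x ->] <-]; apply: sub_sigma_algebra.
  exists (pred1 i), (fun=> x); apply/seteqP; split => u /=.
    by rewrite in_itv/= andbT => -[_ xu] k /eqP ->.
  by move=> h; split => //; rewrite in_itv/= andbT; apply: h => /=.
by have := idm measurableT A mA; rewrite setTI.
Qed.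

End laplace_unique.

Lemma laplace_distribution_unique (R : realType) (m : nat)
    d (T : measurableType d) (P : probability T R) (U : {RV P >-> m.-tuple R})
    d' (T' : measurableType d') (Q : probability T' R) (V : {RV Q >-> m.-tuple R}) :
  {ae P, forall w k, 0 <= tnth (U w) k} -> {ae Q, forall w k, 0 <= tnth (V w) k} ->
  (forall xi : 'I_m -> R, (forall k, 0 <= xi k) ->
    (\int[P]_w (expR (- \sum_k xi k * tnth (U w) k))%:E =
     \int[Q]_w (expR (- \sum_k xi k * tnth (V w) k))%:E)%E) ->
  forall B, measurable B -> distribution P U B = distribution Q V B.
Proof.
pose D : set (m.-tuple R) := [set u | forall k, 0 <= tnth u k].
have mD : measurable D.
  rewrite (_ : D = \bigcap_(k in [set: 'I_m]) (fun u => tnth u k) @^-1` `[0, +oo[).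
    apply: fin_bigcap_measurable => // k _.
    by rewrite -[X in measurable X]setTI; exact: measurable_tnth.
  by apply/seteqP; split => u /= Du k /=; have := Du k; rewrite /= in_itv/= andbT//; apply.
have null d0 (T0 : measurableType d0) (P0 : probability T0 R) (U0 : {RV P0 >-> m.-tuple R}) :
    {ae P0, forall w k, 0 <= tnth (U0 w) k} -> distribution P0 U0 (~` D) = 0%E.
  move=> [N [mN N0 DN]]; rewrite /distribution /pushforward.
  apply: (subset_measure0 _ mN _ N0); last first.
    by move=> w /= Dw; apply: DN => /= h; apply: Dw => k; exact: h.
  by rewrite -[X in measurable X]setTI; apply: measurable_funPT => //; exact: measurableC.
have lap d0 (T0 : measurableType d0) (P0 : probability T0 R) (U0 : {RV P0 >-> m.-tuple R})
    (xi : 'I_m -> R) : {ae P0, forall w k, 0 <= tnth (U0 w) k} ->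
    (\int[distribution P0 U0]_(u in D) (expR (- \sum_k xi k * tnth u k))%:E =
     \int[P0]_w (expR (- \sum_k xi k * tnth (U0 w) k))%:E)%E.
  move=> U0pos; pose h (u : m.-tuple R) := (expR (- \sum_k xi k * tnth u k))%:E.
  have mh : measurable_fun setT h.
    apply/measurable_EFinP; apply: measurableT_comp => //; apply: measurableT_comp => //.
    by apply: measurable_sum => k; apply: measurable_funM => //; exact: measurable_tnth.
  have h0 u : (0 <= h u)%E by rewrite lee_fin expR_ge0.
  rewrite -(ge0_integral_distribution U0 mh h0).
  rewrite -[in RHS](setUv D) ge0_integral_setU//=.
  - rewrite [X in (_ + X)%E]null_set_integral ?adde0//.
    + exact: measurableC.
    + exact: measurable_funTS.
    + exact: null U0pos.
  - exact: measurableC.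
  - by rewrite setUv.
  - exact/disj_setPCl.
move=> Upos Vpos UV B mB.
apply: (laplace_unique (mu1 := distribution P U) (mu2 := distribution Q V)) => //.
- exact: null.
- exact: null.
- by move=> xi xi0; rewrite !lap//; exact: UV.
Qed.

(** * The intertwiner *)

(* The state s of the swap process lists the labels by position.  The state l of
   the growth process lists the row lengths of the diagram of cells (i, j) whose
   weight has elapsed; it is contained in the staircase (m, ..., 2, 1), and the
   event k is that the k-th cell of the antidiagonal is reached. *)
Definition osp_next (k : nat) (s : seq nat) : seq nat :=
  if (nth 0%N s k < nth 0%N s k.+1)%N
  then set_nth 0%N (set_nth 0%N s k (nth 0%N s k.+1)) k.+1 (nth 0%N s k) else s.

(** For a permutation, this says that the first [k.+1] positions hold the [k.+1] largest labels. *)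
Definition osp_done (s : seq nat) (k : nat) : bool :=
  all (fun a => size s - k.+1 <= a)%N (take k.+1 s).

Definition addable (l : seq nat) : seq nat :=
  [seq i <- iota 0 (size l) | (nth 0%N l i < size l - i)%N &&
     ((i == 0%N) || (nth 0%N l i < nth 0%N l i.-1)%N)].

Definition grow (l : seq nat) (i : nat) : seq nat := set_nth 0%N l i (nth 0%N l i).+1.

Definition lpp_done (l : seq nat) (k : nat) : bool :=
  (k < nth 0%N l ((size l).-1 - k))%N.

Definition full_diagram (m : nat) : seq nat := rev (iota 1 m).

Notation lincomb := (seq (seq nat * int)).

(* A trie holding the coefficients of a linear combination of words of length d.
   The operations of int are used directly, without the ring structures, so that
   the computations below remain fast. *)
Fixpoint tensor (d : nat) : Type := if d is d'.+1 then seq (tensor d') else int.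

Fixpoint tensor0 d : tensor d :=
  match d with 0 => 0%:Z | d'.+1 => [::] end.

Fixpoint tensor_add d (p : seq nat) (a : int) : tensor d -> tensor d :=
  match d with
  | 0 => fun t => intZmod.addz t a
  | d'.+1 => fun t => let x := head 0%N p in
     set_nth (tensor0 d') t x (tensor_add (behead p) a (nth (tensor0 d') t x))
  end.

Fixpoint tensor_is0 d : tensor d -> bool :=
  match d with
  | 0 => fun t => if t is Posz 0 then true else false
  | d'.+1 => fun t => all (@tensor_is0 d') t
  end.

Fixpoint tensor_lincomb d : tensor d -> lincomb :=
  match d with
  | 0 => fun t => if t is Posz 0 then [::] else [:: ([::], t)]
  | d'.+1 => fun t => flatten [seq [seq (x :: p.1, p.2) | p <- @tensor_lincomb d' (nth (tensor0 d') t x)]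
                          | x <- iota 0 (size t)]
  end.

Definition collect d (L : lincomb) : tensor d :=
  foldr (fun t => tensor_add t.1 t.2) (tensor0 d) L.

Definition normalize d (L : lincomb) : lincomb := tensor_lincomb (collect d L).

Definition scale (a : int) (L : lincomb) : lincomb := [seq (t.1, intRing.mulz a t.2) | t <- L].

(* The linear extension u_k of s |-> osp_next k s - s. *)
Definition hecke_op (k : nat) (L : lincomb) : lincomb :=
  flatten [seq (if (nth 0%N t.1 k < nth 0%N t.1 k.+1)%N
                then [:: (osp_next k t.1, t.2); (t.1, intZmod.oppz t.2)] else [::]) | t <- L].

(* The coefficients of the powers of t in (1 + t u_(n-2)) ... (1 + t u_0) L. *)
Definition elementary (n : nat) (L : lincomb) : seq lincomb :=
  foldl (fun E k => [seq normalize n (p.1 ++ hecke_op k p.2) | p <- zip E ([::] :: E)])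
        (L :: nseq n.-1 [::]) (iota 0 n.-1).

(* The coefficient of t^k in (1 - t)^-(i+1) \prod_j (1 + t u_j) applied to L, if E
   is elementary n L. *)
Definition flagged (n i k : nat) (E : seq lincomb) : lincomb :=
  flatten [seq scale ('C(i + k - j, k - j))%:Z (nth [::] E j) | j <- iota 0 (minn k n.-1).+1].

Fixpoint subsets (r : nat) (l : seq nat) : seq (seq nat) :=
  match l, r with
  | _, 0 => [:: [::]]
  | [::], _ => [::]
  | x :: l', r'.+1 => [seq x :: C | C <- subsets r' l'] ++ subsets r l'
  end.

(* Associates to each set C of i columns the minor of the first i rows of the
   determinant, in the form of the list elementary n of its value. *)
Definition minors := seq (seq nat * seq lincomb).

Definition lookup (M : minors) (C : seq nat) : seq lincomb :=
  (nth ([::], [::]) M (find (fun p => p.1 == C) M)).2.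

(* Laplace expansion along the row i, whose entry in column c is the operator
   flagged n i (x + c - i), where x is the length of the row i of the diagram. *)
Definition next_row (n i x : nat) (M : minors) : minors :=
  [seq (C, elementary n (normalize n (flatten
     [seq (if (i <= x + nth 0%N C t)%N then
        scale ((-1) ^+ (i - t)) (flagged n i (x + nth 0%N C t - i) (lookup M (take t C ++ drop t.+1 C)))
        else [::]) | t <- iota 0 i.+1])))
   | C <- subsets i.+1 (iota 0 n.-1)].

(** Enumerates the diagrams inside the staircase row by row: [pre] holds the first [i] rows, [b]
    bounds the next one, and [M] holds the minors of these rows. Rows of length 0 make the
    determinant block triangular, so that it reduces to the minor on the first [i] columns; the
    entry 0 of its [elementary] list is its value. *)
Fixpoint jacobi_trudi (fuel n i b : nat) (pre : seq nat) (M : minors) : seq (seq nat * lincomb) :=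
  (pre ++ nseq (n.-1 - i) 0%N, nth [::] (lookup M (iota 0 i)) 0) ::
  if fuel is fuel'.+1 then
    flatten [seq jacobi_trudi fuel' n i.+1 x (rcons pre x) (next_row n i x M)
            | x <- iota 1 (minn b (n.-1 - i))]
  else [::].

Definition intertwiner (n : nat) : seq (seq nat * lincomb) :=
  jacobi_trudi n.-1 n 0 n.-1 [::] [:: ([::], elementary n [:: (iota 0 n, 1%:Z)])].

Definition coef (T : seq (seq nat * lincomb)) (l : seq nat) : lincomb :=
  (nth ([::], [::]) T (find (fun p => p.1 == l) T)).2.

(** The difference of the two sides of the first-step equation of [l] after substituting the
    combinations [coef T]. The costs do not appear: they cancel when the words of [N] have the same
    pending events as [l]. *)
Definition intertwining_defect (T : seq (seq nat * lincomb)) (l : seq nat) : lincomb :=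
  let N := coef T l in
  flatten [seq [seq (osp_next k t.1, t.2) | k <- iota 0 (size l)] | t <- N] ++
  scale (intZmod.addz (size (addable l))%:Z (intZmod.oppz (size l)%:Z)) N ++
  flatten [seq scale (Negz 0) (coef T (grow l i)) | i <- addable l].

(** The size conditions make [collect] faithful. The reversed word is excluded before the full
    diagram, since it is absorbing and the first-step equation is only available at the other
    words. *)
Definition check_state (T : seq (seq nat * lincomb)) (l : seq nat) : bool :=
  let m := size l in let N := coef T l in
  [&& all (fun t => size t.1 == m.+1) N,
      all (fun t => all (fun k => osp_done t.1 k == lpp_done l k) (iota 0 m)) N &
      if l == full_diagram m then N == [:: (rev (iota 0 m.+1), 1%:Z)] else
      [&& addable l != [::],
          all (fun i => grow l i \in [seq p.1 | p <- T]) (addable l),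
          all (fun t => size t.1 == m.+1) (intertwining_defect T l),
          all (fun t => t.1 != rev (iota 0 m.+1)) N &
          tensor_is0 (collect m.+1 (intertwining_defect T l))]].

Definition check_table (n : nat) (T : seq (seq nat * lincomb)) : bool :=
  [&& all (fun p => size p.1 == n.-1) T,
      nseq n.-1 0%N \in [seq p.1 | p <- T],
      coef T (nseq n.-1 0%N) == [:: (iota 0 n, 1%:Z)] &
      all (check_state T) [seq p.1 | p <- T]].

(** * Evaluation of linear combinations of words, and soundness of the zero test *)

Section lincomb_eval.
Variable R : pzRingType.
Implicit Types (phi : seq nat -> R) (L : lincomb).

Definition lc phi L : R := \sum_(t <- L) t.2%:~R * phi t.1.

Lemma lc_cat phi L1 L2 : lc phi (L1 ++ L2) = lc phi L1 + lc phi L2.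
Proof. by rewrite /lc big_cat. Qed.

Lemma lc_flatten (I : Type) phi (r : seq I) (f : I -> lincomb) :
  lc phi (flatten [seq f i | i <- r]) = \sum_(i <- r) lc phi (f i).
Proof. by rewrite /lc big_flatten/= big_map. Qed.

Lemma lc_scale phi a L : lc phi (scale a L) = a%:~R * lc phi L.
Proof.
rewrite /lc big_map mulr_sumr; apply: eq_bigr => t _ /=.
by rewrite -[intRing.mulz _ _]/(a * t.2) intrM mulrA.
Qed.

Fixpoint tensor_eval d : tensor d -> (seq nat -> R) -> R :=
  match d with
  | 0 => fun t phi => t%:~R * phi [::]
  | d'.+1 => fun t phi =>
      \sum_(x < size t) tensor_eval (nth (tensor0 d') t x) (fun p => phi (val x :: p))
  end.

Lemma tensor_eval0 d phi : tensor_eval (tensor0 d) phi = 0.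
Proof. by case: d => [|d] /=; [rewrite mul0r|rewrite big_ord0]. Qed.

Lemma tensor_eval_widen d (t : seq (tensor d)) phi M : (size t <= M)%N ->
  \sum_(x < M) tensor_eval (nth (tensor0 d) t x) (fun p => phi (val x :: p)) =
  \sum_(x < size t) tensor_eval (nth (tensor0 d) t x) (fun p => phi (val x :: p)).
Proof.
move=> tM.
rewrite -(big_mkord xpredT (fun x => tensor_eval (nth (tensor0 d) t x) (fun p => phi (x :: p)))).
rewrite -(big_mkord xpredT (fun x => tensor_eval (nth (tensor0 d) t x) (fun p => phi (x :: p)))).
rewrite (big_cat_nat (leq0n _) tM)/= [X in _ + X]big_nat_cond [X in _ + X]big1 ?addr0// => x.
by rewrite andbT => /andP[tx _]; rewrite nth_default// tensor_eval0.
Qed.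

Lemma tensor_eval_add d p a (t : tensor d) phi : size p = d ->
  tensor_eval (tensor_add p a t) phi = tensor_eval t phi + a%:~R * phi p.
Proof.
elim: d p a t phi => [|d IH] p a t phi.
  by case: p => // _; rewrite /= -[intZmod.addz _ _]/(t + a) intrD mulrDl.
case: p => // x p [sp].
pose y := tensor_add p a (nth (tensor0 d) t x).
(* [set_nth] may lengthen the list, so both sums are extended to a common length. *)
pose M := maxn (size t) x.+1.
have xM : (x < M)%N by rewrite /M leq_max leqnn orbT.
rewrite [LHS](_ : _ = \sum_(i < M) tensor_eval (nth (tensor0 d) (set_nth (tensor0 d) t x y) i)
    (fun p => phi (val i :: p))); last first.
  by rewrite tensor_eval_widen// size_set_nth maxnC.
rewrite [X in X + _](_ : _ = \sum_(i < M) tensor_eval (nth (tensor0 d) t i)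
    (fun p => phi (val i :: p))); last by rewrite tensor_eval_widen// leq_maxl.
rewrite (bigD1 (Ordinal xM))//= [X in _ = X + _](bigD1 (Ordinal xM))//=.
rewrite nth_set_nth/= eqxx IH// addrAC; congr (_ + _ + _).
by apply: eq_bigr => i; rewrite -val_eqE/= nth_set_nth/= => /negPf ->.
Qed.

Lemma tensor_eval_collect d L phi : all (fun t => size t.1 == d) L ->
  tensor_eval (collect d L) phi = lc phi L.
Proof.
rewrite /lc; elim: L => [|[p a] L IH] /=; first by rewrite tensor_eval0 big_nil.
by case/andP => /eqP sp /IH {}IH; rewrite tensor_eval_add// IH big_cons addrC.
Qed.

Lemma tensor_is0_eval d (t : tensor d) phi : tensor_is0 t -> tensor_eval t phi = 0.
Proof.
elim: d t phi => [[[]|]//= phi _|d IH t phi /all_nthP t0]; first by rewrite mul0r.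
by rewrite /= big1// => x _; apply: IH; exact: t0.
Qed.

Lemma lc_collect0 d L phi : all (fun t => size t.1 == d) L -> tensor_is0 (collect d L) ->
  lc phi L = 0.
Proof. by move=> sL L0; rewrite -(tensor_eval_collect _ sL) tensor_is0_eval. Qed.

End lincomb_eval.

Lemma size_grow l i : (i < size l)%N -> size (grow l i) = size l.
Proof. by move=> il; rewrite size_set_nth; apply/maxn_idPr. Qed.

Lemma sumn_grow l i : (i < size l)%N -> sumn (grow l i) = (sumn l).+1.
Proof.
move=> il; rewrite /grow sumn_set_nth il muln1 mul0n addn0 addnS.
by rewrite subSn ?leq_addl// addnK.
Qed.

Section intertwining.
Variables (R : numFieldType) (n : nat) (T : seq (seq nat * lincomb)).
Hypothesis n0 : (0 < n)%N.
Hypothesis checkT : check_table n T.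
Variable xi : 'I_n.-1 -> R.
Hypothesis xi0 : forall k, 0 <= xi k.

Let cost (F : nat -> bool) : R := \sum_(k < n.-1 | ~~ F k) xi k.

Variables phi h : seq nat -> R.
Hypothesis phi_final : phi (rev (iota 0 n)) = 1.
Hypothesis phi_step : forall s, size s = n -> s != rev (iota 0 n) ->
  (n.-1%:R + cost (osp_done s)) * phi s = \sum_(k <- iota 0 n.-1) phi (osp_next k s).
Hypothesis h_final : h (full_diagram n.-1) = 1.
Hypothesis h_step : forall l, size l = n.-1 -> l != full_diagram n.-1 -> addable l != [::] ->
  ((size (addable l))%:R + cost (lpp_done l)) * h l = \sum_(i <- addable l) h (grow l i).

Let keys := [seq p.1 | p <- T].

(** Induction on the number of cells still to be added. The vanishing defect shows that the
    right-hand side satisfies the equation of [h], which determines the value at [l] from those at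
    the grown diagrams because its coefficient there is positive. *)
Lemma intertwining_value l : l \in keys -> h l = lc phi (coef T l).
Proof.
have /and4P[/allP sT _ _ /allP cT] := checkT.
pose M := \max_(l <- keys) sumn l.
have [k] := ubnP (M - sumn l); elim: k l => // k IH l lk lT.
have sl : size l = n.-1 by move/mapP: lT => [p pT ->]; apply/eqP; exact: sT.
have /and3P[/allP sN /allP FN] := cT l lT.
have nE : n.-1.+1 = n by rewrite prednK.
rewrite sl nE; case: ifPn => [/eqP lf /eqP ->|lf].
  by rewrite /lc big_seq1/= lf h_final phi_final mulr1.
move=> /and5P[addl /allP growT sD /allP nfN D0].
have := lc_collect0 phi sD D0; rewrite /intertwining_defect !lc_cat lc_scale !lc_flatten sl.
rewrite -[intZmod.addz _ _]/((size (addable l))%:Z - n.-1%:Z).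
under eq_bigr => t _ do rewrite /lc big_map.
under [X in _ + (_ + X)]eq_bigr => i _ do rewrite lc_scale mulN1r.
rewrite sumrN => /eqP; rewrite addrA subr_eq0 => /eqP defect.
have d0 : 0 < (size (addable l))%:R + cost (lpp_done l).
  by rewrite ltr_pwDl ?ltr0n ?lt0n ?size_eq0// /cost sumr_ge0.
apply: (mulfI (lt0r_neq0 d0)); rewrite h_step//.
transitivity (\sum_(i <- addable l) lc phi (coef T (grow l i))).
  rewrite !big_seq; apply: eq_bigr => i il; apply: IH; last exact: growT.
  have il' : (i < size l)%N by move: il; rewrite mem_filter mem_iota add0n => /andP[_].
  have gM : (sumn (grow l i) <= M)%N by apply: (@leq_bigmax_seq _ keys xpredT sumn) => //; exact: growT.
  rewrite -ltnS; apply: leq_ltn_trans lk.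
  by move: gM; rewrite sumn_grow// => gM; rewrite subnS prednK ?subn_gt0.
rewrite -defect intrB !pmulrn.
set A := \sum_(t <- _) _; set N := lc _ _.
have -> : A = (n.-1%:R + cost (lpp_done l)) * N; last by ring.
rewrite /A /N /lc mulr_sumr big_seq [RHS]big_seq; apply: eq_bigr => t tN.
have /eqP st := sN t tN.
have -> : cost (lpp_done l) = cost (osp_done t.1).
  apply: eq_bigl => j; congr (~~ _); apply/esym/eqP.
  by apply: (allP (FN t tN)); rewrite mem_iota /= add0n sl.
have st' : size t.1 = n by rewrite st sl.
by rewrite -mulr_sumr mulrCA -(phi_step st' (nfN t tN)).
Qed.

Lemma intertwining : phi (iota 0 n) = h (nseq n.-1 0%N).
Proof.
have /and4P[_ kT /eqP c0 _] := checkT.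
by rewrite intertwining_value// c0 /lc big_seq1 mul1r.
Qed.

End intertwining.

(** * Last passage percolation *)

Lemma lpp_ge0 (R : realType) (x : nat -> nat -> R) i j :
  (forall a b, 0 <= x a b) -> 0 <= lpp x i j.
Proof.
move=> x0; elim: i j => [|i IHi] j; first by rewrite lpp0j.
elim: j => [|j IHj]; first by rewrite lppi0.
by rewrite lppSS addr_ge0// le_max IHj orbT.
Qed.

Section growth.
Variables (R : realType) (m : nat).
Implicit Types (l : seq nat) (v : nat * nat -> R).

Definition diagram l : Prop :=
  [/\ size l = m, forall i, (nth 0%N l i.+1 <= nth 0%N l i)%N &
      forall i, (nth 0%N l i <= m - i)%N].

Lemma nth_grow l i a : nth 0%N (grow l i) a = if a == i then (nth 0%N l i).+1 else nth 0%N l a.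
Proof. by rewrite nth_set_nth. Qed.

Lemma mem_addable l i : size l = m ->
  (i \in addable l) = [&& (i < m)%N, (nth 0%N l i < m - i)%N &
    (i == 0%N) || (nth 0%N l i < nth 0%N l i.-1)%N].
Proof. by move=> sl; rewrite mem_filter mem_iota sl add0n/= andbC. Qed.

Lemma diagram_grow l i : diagram l -> i \in addable l -> diagram (grow l i).
Proof.
move=> [sl dl bl]; rewrite mem_addable// => /and3P[im lt lti]; split.
- by rewrite size_grow ?sl.
- move=> a; rewrite !nth_grow; case: eqP => [ai|_]; case: eqP => [ai'|_].
  + by exfalso; lia.
  + by move: lti; rewrite -ai.
  + by rewrite -ai'; exact: leqW (dl a).
  + exact: dl.
- by move=> a; rewrite nth_grow; case: eqP => [->|_].
Qed.

Lemma diagram_nseq : diagram (nseq m 0%N).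
Proof.
by split => [|i|i]; rewrite ?size_nseq// !nth_nseq !if_same.
Qed.

Lemma nth_full_diagram i : nth 0%N (full_diagram m) i = (m - i)%N.
Proof.
rewrite /full_diagram; have [im|im] := ltnP i m; last first.
  by rewrite nth_default ?size_rev ?size_iota//; lia.
by rewrite nth_rev ?size_iota// nth_iota; lia.
Qed.

Lemma diagram_not_full l : diagram l -> l != full_diagram m -> exists i, i \in addable l.
Proof.
move=> [sl dl bl] lf.
have [i lti] : exists i, (nth 0%N l i < m - i)%N.
  apply: contrapT => /forallNP h; move/eqP: lf; apply.
  apply: (@eq_from_nth _ 0%N); first by rewrite size_rev size_iota.
  by move=> i _; rewrite nth_full_diagram; have := h i; have := bl i; lia.
have [i0 ] := @ex_minnP (fun i => nth 0%N l i < m - i)%N (ex_intro _ i lti).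
move=> lti0 min0; exists i0; rewrite mem_addable//; apply/and3P; split => //; first lia.
case: i0 lti0 min0 => // a lta mina /=.
have [h|h] := ltnP (nth 0%N l a) (m - a); first by have := mina a h; lia.
by lia.
Qed.

Lemma sumn_diagram l : diagram l -> (sumn l <= m * m)%N.
Proof.
move=> [sl _ bl]; rewrite sumnE (@leq_trans (\sum_(x <- l) m))//.
  rewrite !big_seq; apply: leq_sum => x /(nthP 0%N)[i _ <-].
  by rewrite (leq_trans (bl i))// leq_subr.
by rewrite big_const_seq count_predT sl iter_addn_0.
Qed.

(* Here v (i, k) is the residual weight of the k-th cell of the row i that is not
   in the diagram l. *)
Definition residual_weights l v (i j : nat) : R :=
  if (j < nth 0%N l i)%N then 0 else v (i, (j - nth 0%N l i)%N).

Lemma residual_weights_ge0 l v i j : (forall p, 0 <= v p) -> 0 <= residual_weights l v i j.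
Proof. by move=> v0; rewrite /residual_weights; case: ifP. Qed.

(** The cells of the diagram have residual weight 0, and every path to one of them stays in the
    diagram. *)
Lemma lpp_residual_inside l v i j : diagram l -> (j < nth 0%N l i)%N ->
  lpp (residual_weights l v) i.+1 j.+1 = 0.
Proof.
move=> [_ dl _].
have W0 a b : (b < nth 0%N l a)%N -> residual_weights l v a b = 0.
  by move=> ab; rewrite /residual_weights ab.
elim: i j => [|i IHi] j ji.
  elim: j ji => [|j IHj] ji; rewrite lppSS lpp0j W0// addr0.
    by rewrite lppi0 maxxx.
  by rewrite IHj ?maxxx// ltnW.
have ji' := leq_trans ji (dl i).
elim: j ji ji' => [|j IHj] ji ji'; rewrite lppSS W0// addr0 IHi//.
  by rewrite lppi0 maxxx.
by rewrite IHj ?maxxx//; exact: ltnW.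
Qed.

Lemma uniq_addable l : uniq (addable l).
Proof. by rewrite filter_uniq// iota_uniq. Qed.

(** At an addable corner the predecessors have passage time 0 and the weight itself loses
    [v (i0, 0)]. At any other cell outside the diagram the weight is unchanged and at least one
    predecessor is also outside, which transmits the shift. *)
Lemma lpp_residual_step l v i0 i j : diagram l -> (forall p, 0 <= v p) ->
  i0 \in addable l -> first_ring i0 (addable l) v ->
  (i + j < m)%N -> (nth 0%N l i <= j)%N ->
  lpp (residual_weights l v) i.+1 j.+1 = v (i0, 0%N) +
  lpp (residual_weights (grow l i0) (next_config i0 (addable l) v)) i.+1 j.+1.
Proof.
move=> dl v0 i0l fr; have dg := diagram_grow dl i0l.
have [sl dec _] := dl.
set W := residual_weights l v; set W' := residual_weights _ _.
have W'0 a b : 0 <= W' a b.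
  by apply: residual_weights_ge0; exact: next_config_ge0.
have lW'0 a b : 0 <= lpp W' a b := lpp_ge0 a b W'0.
have ins a b : (b < nth 0%N l a)%N -> lpp W a.+1 b.+1 = 0 /\ lpp W' a.+1 b.+1 = 0.
  move=> ab; rewrite !lpp_residual_inside// nth_grow; case: eqP => // <-.
  exact: ltnW.
(* The shift passes through a maximum when one argument is shifted and the other is either shifted
   too or 0 before and after. *)
have maxs (a a' b b' : R) : 0 <= a' -> 0 <= b' ->
    (a = v (i0, 0%N) + a' /\ (b = v (i0, 0%N) + b' \/ b = 0 /\ b' = 0)) \/
    (b = v (i0, 0%N) + b' /\ (a = v (i0, 0%N) + a' \/ a = 0 /\ a' = 0)) ->
    Num.max a b = v (i0, 0%N) + Num.max a' b'.
  have m0 := v0 (i0, 0%N).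
  move=> a0 b0; rewrite addr_maxr; case=> -[-> [->//|[-> ->]]].
    by rewrite addr0 !max_l// ?addr_ge0// lerDl.
  by rewrite addr0 !max_r// ?addr_ge0// lerDl.
have addab a b : (a + b < m)%N -> nth 0%N l a = b ->
    (forall a', a = a'.+1 -> (b < nth 0%N l a')%N) -> a \in addable l.
  move=> abm lab h; rewrite mem_addable//; apply/and3P; split.
  - by lia.
  - by rewrite lab; lia.
  - by case: a abm lab h => // a abm lab h /=; rewrite lab h.
have weight a b : (nth 0%N l a <= b)%N -> (nth 0%N l a == b) && (a \in addable l) = false ->
    W a b = W' a b.
  move=> lab notadd; rewrite /W /W' /residual_weights ltnNge lab/= nth_grow.
  have [ai|ai] := eqVneq a i0.
    move: notadd; rewrite ai i0l andbT => /negbT lb; rewrite -ai in lb *.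
    have lb' : (nth 0%N l a < b)%N by rewrite ltn_neqAle lb lab.
    by rewrite ltnS leqNgt lb'/= next_config_row subnSK.
  rewrite ltnNge lab/= next_config_other//.
  by move: notadd; have [/eqP ->|] := boolP (nth 0%N l a == b) => /= [->|]; rewrite ?orbT//; lia.
have corner a b : nth 0%N l a = b -> a \in addable l ->
    W a b = v (i0, 0%N) + W' a b.
  move=> lab aadd; rewrite /W /W' /residual_weights lab ltnn subnn nth_grow.
  have [ai|ai] := eqVneq a i0; first by rewrite -ai lab ltnSn addr0.
  by rewrite lab ltnn subnn next_config_racing// ?uniq_addable// addrC subrK.
have L0 x j' : lpp x 0 j' = 0 :> R by [].
have Li0 x i' : lpp x i' 0 = 0 :> R by exact: lppi0.
have LS x i' j' : lpp x i'.+1 j'.+1 = Num.max (lpp x i' j'.+1) (lpp x i'.+1 j') + x i' j' :> R.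
  by [].
(* From here on only the recursions of the two passage times are used, so both functions are
   generalized. *)
move: (lpp W) (lpp W') (L0 W) (L0 W') (Li0 W) (Li0 W') (LS W) (LS W') lW'0 ins.
move=> L L' {}L0 L0' {}Li0 Li0' {}LS LS' L'0 ins.
elim: i j => [|i IHi] j.
  rewrite add0n; elim: j => [|j IHj] jm lj; rewrite LS LS' L0 L0'.
    have l0 : nth 0%N l 0 = 0%N by lia.
    rewrite Li0 Li0' !maxxx !add0r corner//.
    by apply: (@addab 0%N 0%N) => //; lia.
  have [lj'|lj'] := leqP (nth 0%N l 0) j.
    have ne : (nth 0%N l 0 == j.+1) = false by apply/eqP; lia.
    rewrite (maxs 0 0 _ (L' 1 j.+1)) ?weight ?ne ?addrA//.
    by right; split; [apply: IHj; lia|right].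
  have [-> ->] := ins 0%N j lj'; have l0 : nth 0%N l 0 = j.+1 by lia.
  rewrite !maxxx !add0r corner//.
  by apply: (@addab 0%N j.+1) => //; lia.
elim: j => [|j IHj] ijm lj; rewrite LS LS'.
  rewrite Li0 Li0'; have l0 : nth 0%N l i.+1 = 0%N by lia.
  have [lj'|lj'] := leqP (nth 0%N l i) 0.
    have na : (i.+1 \in addable l) = false.
      by rewrite mem_addable//=; apply/negP => /and3P[_ _]; lia.
    rewrite (maxs _ (L' i.+1 1) 0 0) ?weight ?na ?andbF ?addrA//.
    by left; split; [apply: IHi; lia|right].
  have [-> ->] := ins i 0%N lj'.
  rewrite !maxxx !add0r corner//.
  by apply: (@addab i.+1 0%N) => //; move=> a' [<-].
have [lj1|lj1] := leqP (nth 0%N l i.+1) j.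
  have left : L i.+2 j.+1 = v (i0, 0%N) + L' i.+2 j.+1 by apply: IHj; lia.
  have ne : (nth 0%N l i.+1 == j.+1) = false by apply/eqP; lia.
  rewrite (maxs _ (L' i.+1 j.+2) _ (L' i.+2 j.+1)) ?weight ?ne ?addrA//.
  right; split => //.
  have [lj2|lj2] := leqP (nth 0%N l i) j.+1; first by left; apply: IHi; lia.
  by right; exact: ins.
have [l1 l1'] := ins i.+1 j lj1; have l0 : nth 0%N l i.+1 = j.+1 by lia.
have [lj2|lj2] := leqP (nth 0%N l i) j.+1.
  have na : (i.+1 \in addable l) = false.
    by rewrite mem_addable//=; apply/negP => /and3P[_ _]; lia.
  rewrite (maxs _ (L' i.+1 j.+2) _ (L' i.+2 j.+1)) ?weight ?na ?andbF ?addrA//.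
  by left; split; [apply: IHi; lia|right].
have [l2 l2'] := ins i j.+1 lj2.
rewrite l1 l1' l2 l2' !maxxx !add0r corner//.
by apply: (@addab i.+1 j.+1) => //; move=> a' [<-].
Qed.

End growth.

(** * Laplace transform of the passage times *)

Section lpp_laplace.
Variables (R : realType) (n : nat).
Notation m := n.-1.

Definition lpp_rel (l : seq nat) (v : nat * nat -> R) (u : 'I_m -> R) : Prop :=
  [/\ diagram m l, forall p, 0 <= v p &
      forall k : 'I_m, ~~ lpp_done l k -> u k = lpp (residual_weights l v) (m - k) k.+1].

Lemma lpp_rel_final l v u : lpp_rel l v u -> l == full_diagram m -> forall k : 'I_m, lpp_done l k.
Proof.
move=> [[sl _ _] _ _] /eqP lf k; rewrite /lpp_done sl lf nth_full_diagram.
by have := ltn_ord k; lia.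
Qed.

(** A pending passage time loses [v (i, 0)] by [lpp_residual_step]; if its cell enters the diagram
    at this ring, nothing remains, so it was equal to [v (i, 0)]. *)
Lemma lpp_rel_step l v u i : lpp_rel l v u -> i \in addable l -> first_ring i (addable l) v ->
  [/\ lpp_rel (grow l i) (next_config i (addable l) v) (fun k => u k - v (i, 0%N)),
      forall k : 'I_m, lpp_done l k -> lpp_done (grow l i) k &
      forall k : 'I_m, ~~ lpp_done l k -> lpp_done (grow l i) k -> u k = v (i, 0%N)].
Proof.
move=> [dl v0 uE] il fr; have dg := diagram_grow dl il.
have v'0 := next_config_ge0 fr v0.
have [sl dec _] := dl; have [sg _ _] := dg.
have doneE (k : 'I_m) : lpp_done l k = (k < nth 0%N l (m.-1 - k))%N by rewrite /lpp_done sl.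
have doneE' (k : 'I_m) : lpp_done (grow l i) k = (k < nth 0%N (grow l i) (m.-1 - k))%N.
  by rewrite /lpp_done sg.
have mono (k : 'I_m) : lpp_done l k -> lpp_done (grow l i) k.
  by rewrite doneE doneE' nth_grow; case: eqP => // <- /ltnW.
have rowE (k : 'I_m) : (m - k = (m.-1 - k).+1)%N by have := ltn_ord k; lia.
have stepE (k : 'I_m) : ~~ lpp_done l k -> u k = v (i, 0%N) +
    lpp (residual_weights (grow l i) (next_config i (addable l) v)) (m - k) k.+1.
  move=> nk; rewrite uE// rowE; apply: (lpp_residual_step dl) => //.
    by have := ltn_ord k; lia.
  by rewrite leqNgt -doneE.
split=> //.
- split=> // k nk; have nk' : ~~ lpp_done l k by apply: contra nk; exact: mono.
  by rewrite stepE// addrC addKr.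
- move=> k nk; rewrite doneE' => dk; rewrite stepE// rowE (lpp_residual_inside _ dg)//.
  by rewrite addr0.
Qed.

Lemma sumn_grow_lt l i : diagram m l -> i \in addable l ->
  (m * m - sumn (grow l i) < m * m - sumn l)%N.
Proof.
move=> dl il; have := sumn_diagram (diagram_grow dl il).
have [sl _ _] := dl; move: (il); rewrite (mem_addable _ sl) => /andP[im _].
by rewrite sumn_grow ?sl//; lia.
Qed.

Definition lpp_cost (xi : 'I_m -> R) (l : seq nat) : R := \sum_(k < m | ~~ lpp_done l k) xi k.

Definition lpp_limit (xi : 'I_m -> R) : seq nat -> R :=
  race_limit addable grow (fun l => l == full_diagram m) (lpp_cost xi).

Lemma lpp_vector_laplace d (T : measurableType d) (P : probability T R)
    (X : nat * nat -> {RV P >-> R}) (xi : 'I_m -> R) :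
  iid_exponential X 1 -> (forall k, 0 <= xi k) ->
  (\int[P]_w (expR (- \sum_k xi k * tnth (lpp_vector n X w) k))%:E =
   (lpp_limit xi (nseq m 0%N))%:E)%E.
Proof.
move=> iidX xi0.
have X0 : {ae P, forall w, forall i j, 0 <= X (i, j) w}.
  by apply/ae_foralln => i; apply/ae_foralln => j; exact: iid_exponential_ge0.
apply: (@integral_race_limit _ _ _ _ _ _ _ _ _ _ _ _ X) => //.
- by move=> l; exact: uniq_addable.
- by move=> l; exact: sumr_ge0.
- apply: (@race_limit0 _ _ _ _ _ _ _ (diagram m) (fun l => m * m - sumn l)%N).
  + by move=> l; exact: uniq_addable.
  + by move=> l i; exact: diagram_grow.
  + by move=> l i dl _ il; right; exact: sumn_grow_lt.
  + by move=> l dl /(diagram_not_full dl)[i il]; exists i => //; exact: sumn_grow_lt.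
  + exact: diagram_nseq.
- apply: measurableT_comp => //; apply: measurableT_comp => //.
  apply: measurable_sum => k; apply: measurable_funM => //.
  apply: (measurableT_comp (measurable_tnth k)); exact: measurable_lpp_vector.
apply: filterS X0 => w X0; split.
  rewrite expR_le1 oppr_le0 sumr_ge0// => k _; rewrite mulr_ge0// tnth_mktuple.
  by apply: lpp_ge0.
move=> N.
have weightsE : residual_weights (nseq m 0%N) (config_of X w) = fun i j => X (i, j) w.
  apply/funext => i; apply/funext => j; rewrite /residual_weights nth_nseq if_same ltn0 subn0.
  by [].
have notdone (k : 'I_m) : ~~ lpp_done (nseq m 0%N) k.
  by rewrite /lpp_done nth_nseq if_same.
have rel0 : lpp_rel (nseq m 0%N) (config_of X w) (fun k => tnth (lpp_vector n X w) k).
  split; [exact: diagram_nseq|by case=> i j; exact: X0|].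
  move=> k _; rewrite weightsE tnth_mktuple; congr lpp.
  by have := ltn_ord k; lia.
have -> := @race_value_coupling nat R (seq nat) addable grow (fun l => l == full_diagram m) m
  (fun l k => lpp_done l k) xi lpp_rel lpp_rel_final _ N _ _ _ rel0.
  by rewrite (eq_bigl xpredT)// => k; exact: notdone.
by move=> l v u i rel _; exact: lpp_rel_step.
Qed.

End lpp_laplace.

(** * The oriented swap process *)

Section codes.
Variable n : nat.
Implicit Types (p : {perm 'I_n}) (k i : 'I_n.-1).

Definition code p : seq nat := [seq val (p j) | j <- enum 'I_n].

Lemma size_code p : size (code p) = n.
Proof. by rewrite size_map size_enum_ord. Qed.

Lemma nth_code p (j : 'I_n) : nth 0%N (code p) j = p j.
Proof. by rewrite (nth_map j) ?size_enum_ord// nth_ord_enum. Qed.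

Lemma code1 : code 1%g = iota 0 n.
Proof.
rewrite -val_enum_ord; apply: eq_map => j; by rewrite perm1.
Qed.

Lemma osp_next_code k p : osp_next k (code p) = code (osp_step k p).
Proof.
have nl : nth 0%N (code p) k = p (lpos k) := nth_code p (lpos k).
have nr : nth 0%N (code p) k.+1 = p (rpos k) := nth_code p (rpos k).
rewrite /osp_next /osp_step nl nr; case: ifP => // _.
have kn : (k.+1 < n)%N := rpos_subproof k.
apply: (@eq_from_nth _ 0%N).
  by rewrite !size_set_nth !size_code; lia.
move=> j; rewrite !size_set_nth size_code => jn.
have {}jn : (j < n)%N by lia.
have -> : nth 0%N (code (exchange k p)) j = exchange k p (Ordinal jn).
  exact: (nth_code _ (Ordinal jn)).
rewrite /exchange permM !nth_set_nth /=.
have [jk1|jk1] := eqVneq j k.+1.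
  rewrite (_ : Ordinal _ = rpos k); last exact: val_inj.
  by rewrite tpermR.
rewrite nth_set_nth /=.
have [jk|jk] := eqVneq j k.
  rewrite (_ : Ordinal _ = lpos k); last exact: val_inj.
  by rewrite tpermL.
rewrite tpermD -?val_eqE/= 1?eq_sym//.
exact: (nth_code _ (Ordinal jn)).
Qed.

(* No swap can occur any more between the positions k and k.+1. *)
Definition settled p k : Prop := forall j : 'I_n, (j <= k)%N -> (n - k.+1 <= p j)%N.

Lemma osp_doneP p k : reflect (settled p k) (osp_done (code p) k).
Proof.
have kn : (k.+1 < n)%N := rpos_subproof k.
rewrite /osp_done size_code; apply: (iffP (all_nthP 0%N)) => H.
  move=> j jk; have := H j; rewrite size_take size_code kn ltnS => /(_ jk).
  by rewrite nth_take ?ltnS// nth_code.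
move=> j; rewrite size_take size_code kn ltnS => jk.
rewrite nth_take ?ltnS//.
have jn : (j < n)%N by lia.
by rewrite (nth_code p (Ordinal jn)); exact: H.
Qed.

(* The labels at the [k.+1] first positions of a settled configuration are the
   [k.+1] largest ones, so that the next label is smaller. *)
Lemma settled_no_ascent p k : settled p k -> (p (lpos k) < p (rpos k))%N = false.
Proof.
move=> pk; apply/negbTE/negP => asc.
have kn : (k.+1 < n)%N := rpos_subproof k.
pose A := [set j : 'I_n | (j <= k.+1)%N]%SET.
pose B := [set j : 'I_n | (n - k.+1 <= j)%N]%SET.
have AB : (p @: A \subset B)%SET.
  apply/fintype.subsetP => _ /imsetP[j jA ->]; rewrite inE; move: jA; rewrite inE leq_eqVlt.
  case/predU1P => [jk|]; last by rewrite ltnS; exact: pk.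
  have -> : j = rpos k by apply: val_inj.
  by rewrite (leq_trans _ (ltnW asc))//; apply: pk.
have := subset_leq_card AB; rewrite card_imset; last exact: perm_inj.
have cardA : #|A| = k.+2.
  rewrite -sum1dep_card (eq_bigl (fun j : 'I_n => (j < k.+2)%N))//.
  by rewrite (big_ord_narrow kn) sum1_card card_ord.
have cardB : #|B| = k.+1.
  have := cardsC B; rewrite card_ord.
  have -> : (~: B)%SET = [set j : 'I_n | (j < n - k.+1)%N]%SET.
    by apply/setP => j; rewrite !inE -ltnNge.
  rewrite -[X in (_ + X)%N]sum1dep_card (big_ord_narrow (leq_subr _ _)) sum1_card card_ord.
  by lia.
by rewrite cardA cardB ltnn.
Qed.

Lemma tperm_pos_le k i (j : 'I_n) : k != i -> (tperm (lpos i) (rpos i) j <= k)%N = (j <= k)%N.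
Proof.
rewrite -val_eqE/= => ki; case: tpermP => [->|->|//] /=; lia.
Qed.

Lemma settled_exchange p k i : k != i -> settled p k -> settled (exchange i p) k.
Proof. by move=> ki pk j jk; rewrite permM; apply: pk; rewrite tperm_pos_le. Qed.

Lemma exchangeK i : involutive (@exchange n i).
Proof. by move=> p; rewrite /exchange mulgA tperm2 mul1g. Qed.

(** An exchange elsewhere permutes the first [k.+1] positions among themselves, and one at [k] would
    need an ascent there. *)
Lemma settled_step p k i : settled p k -> settled (osp_step i p) k.
Proof.
rewrite /osp_step => pk; case: ifP => // asc.
have [ki|ki] := eqVneq k i; last exact: settled_exchange.
by move: asc; rewrite -ki settled_no_ascent.
Qed.

(** An exchange at [i != k] could be undone by the same exchange, which preserves being settled. *)
Lemma newly_settled p k i : ~ settled p k -> settled (osp_step i p) k ->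
  k = i /\ osp_step i p = exchange i p.
Proof.
rewrite /osp_step; case: ifP => // asc npk pk.
have [ki|ki] := eqVneq k i => //.
by case: npk; rewrite -(exchangeK i p); exact: settled_exchange.
Qed.

Lemma osp_done_final k : osp_done (rev (iota 0 n)) k.
Proof.
have kn : (k.+1 < n)%N := rpos_subproof k.
rewrite /osp_done size_rev size_iota; apply/(all_nthP 0%N) => j.
rewrite size_take size_rev size_iota kn ltnS => jk.
by rewrite nth_take ?ltnS// nth_rev ?size_iota ?nth_iota; lia.
Qed.

(** Decreases at each effective swap, which moves the larger label to the left; it serves as the
    measure for absorption. *)
Definition moment (s : seq nat) : nat := \sum_(j < n) j * nth 0%N s j.

Lemma moment_step k p : (p (lpos k) < p (rpos k))%N ->
  (moment (osp_next k (code p)) < moment (code p))%N.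
Proof.
move=> asc; rewrite osp_next_code /osp_step asc /moment.
have lr : rpos k != lpos k by rewrite -val_eqE/=; lia.
rewrite (bigD1 (lpos k))// (bigD1 (rpos k))//=.
rewrite [X in (_ < X)%N](bigD1 (lpos k))// [X in (_ < _ + X)%N](bigD1 (rpos k))//=.
have nl q : nth 0%N (code q) (lpos k) = q (lpos k) := nth_code q (lpos k).
have nr q : nth 0%N (code q) (lpos k).+1 = q (rpos k) := nth_code q (rpos k).
rewrite !nl !nr !permM tpermL tpermR.
set a := (\sum_(_ < _ | _) _)%N; set b := (\sum_(_ < _ | _) _)%N.
have -> : a = b.
  apply: eq_bigr => j /andP[jl jr].
  by rewrite !nth_code permM tpermD// eq_sym.
rewrite /=; nia.
Qed.

Lemma code_no_ascent p : (forall k, (p (lpos k) < p (rpos k))%N = false) -> code p = rev (iota 0 n).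
Proof.
move=> noasc; apply: (@sorted_eq _ geq).
- by move=> a b c ba cb; exact: leq_trans cb ba.
- by move=> a b; rewrite andbC => /anti_leq.
- apply/(sortedP 0%N) => j; rewrite size_code => jn.
  have jn' : (j < n.-1)%N by lia.
  have := noasc (Ordinal jn').
  by rewrite -(nth_code p (lpos (Ordinal jn'))) -(nth_code p (rpos (Ordinal jn'))) /=; lia.
- by rewrite rev_sorted; have := iota_sorted 0 n.
apply: uniq_perm.
- by rewrite map_inj_uniq ?enum_uniq// => i j /val_inj /perm_inj.
- by rewrite rev_uniq iota_uniq.
move=> x; rewrite mem_rev mem_iota add0n /=; apply/mapP/idP => [[j _ ->]|xn]; first exact: ltn_ord.
by exists (p^-1%g (Ordinal xn)); rewrite ?mem_enum ?permKV.
Qed.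

End codes.

(** * Pathwise properties of the swap process *)

Section trajectory.
Context {n : nat} {R : realType}.
Variables (rings : 'I_n.-1 -> set R) (eta : R -> {perm 'I_n}).
Hypothesis eta_osp : osp_trajectory rings eta.

Lemma left_value_ex a t (P : set {perm 'I_n}) : a < t ->
  (\forall u \near t^'-, P (eta u)) -> exists x, P (eta x) /\ a <= x < t.
Proof.
move=> at_ lp; apply: (@filter_ex _ (at_left t)); near=> x; split; first by near: x.
apply/andP; split; first by near: x; exact: nbhs_left_ge.
by near: x; exact: nbhs_left_lt.
Unshelve. all: by end_near. Qed.

Lemma left_value_unique t (p q : {perm 'I_n}) :
  left_value eta t p -> left_value eta t q -> p = q.
Proof.
move=> hp hq; have t1 : t - 1 < t by rewrite ltrBlDr ltrDl.
have [||x [[<- <-]]//] := @left_value_ex (t - 1) t [set r | r = p /\ r = q].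
  exact: t1.
by near=> u; split; near: u.
Unshelve. all: by end_near. Qed.

Lemma left_value_itv a t (p : {perm 'I_n}) : a < t ->
  (forall u, a <= u < t -> eta u = p) -> left_value eta t p.
Proof.
move=> at_ h; near=> u; apply: h; apply/andP; split; last by near: u; exact: nbhs_left_lt.
by near: u; exact: nbhs_left_ge.
Unshelve. all: by end_near. Qed.

Lemma trajectory_invariant (Q : {perm 'I_n} -> Prop) a b : 0 <= a -> Q (eta a) ->
  (forall t p, a < t < b -> left_value eta t p -> Q p -> Q (eta t)) ->
  forall t, a <= t < b -> Q (eta t).
Proof.
move=> a0 Qa jump t /andP[at_ tb]; apply: contrapT => nQt.
have [_ rc lv] := eta_osp.
pose E := [set x | a <= x <= t /\ forall y, a <= y <= x -> Q (eta y)].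
have Ea : E a.
  by split=> [|y]; rewrite ?lexx//= => ya; rewrite -(le_anti ya).
have supE : has_sup E by split; [exists a|exists t => x [/andP[]]].
pose c := sup E.
have ac : a <= c by exact: ub_le_sup supE.2 _ Ea.
have ct : c <= t by apply: ge_sup; [exists a|move=> x [/andP[]]].
have Qlt y : a <= y < c -> Q (eta y).
  move=> /andP[ay yc].
  have [x [_ Ex] yx] := sup_gt supE.1 yc.
  by apply: Ex; rewrite ay ltW.
have Qc : Q (eta c).
  have [ca|ca] := eqVneq c a; first by rewrite ca.
  have {ca} ac' : a < c by rewrite lt_neqAle eq_sym ca.
  have [p [lp _ _]] := lv c (le_lt_trans a0 ac').
  apply: (jump c p) => //; first by rewrite ac' (le_lt_trans ct).
  have [x [xp axc]] := @left_value_ex a c (fun q => q = p) ac' lp.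
  by rewrite -xp; exact: Qlt.
have {}ct : c < t.
  by rewrite lt_neqAle ct andbT; apply/eqP => cE; apply: nQt; rewrite -cE.
have := rc c (le_trans a0 ac); rewrite near_withinE => /nbhs_ballP[e /= e0 ce].
pose d := Num.min (c + e / 2) t.
have cd : c < d by rewrite lt_min ct andbT ltrDl divr_gt0.
have Ed : E d.
  split; first by rewrite (le_trans ac (ltW cd)) ge_min lexx orbT.
  move=> y /andP[ay yd]; have [yc|cy|->//] := ltgtP y c; first by apply: Qlt; rewrite ay.
  rewrite (ce y)//= /ball/= distrC gtr0_norm ?subr_gt0// ltrBlDl.
  rewrite (le_lt_trans yd)// gt_min ltrD2l ltr_pdivrMr// ltr_pMr// ltr1n.
  by rewrite orTb.
by have := ub_le_sup supE.2 Ed; rewrite leNgt cd.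
Qed.

Lemma trajectory_constant a b : 0 <= a -> (forall k t, a < t < b -> ~ rings k t) ->
  forall t, a <= t < b -> eta t = eta a.
Proof.
move=> a0 norings; apply: (@trajectory_invariant (fun p => p = eta a)) => // t p tab lp pa.
have [_ _ lv] := eta_osp.
have /lv[q [lq _ same]] : 0 < t by rewrite (le_lt_trans a0)//; case/andP: tab.
by rewrite same => [|k]; [rewrite (left_value_unique lq lp)|exact: norings].
Qed.

Lemma trajectory_settled k a t : 0 <= a -> settled (eta a) k -> a <= t -> settled (eta t) k.
Proof.
move=> a0 sa at_; apply: (@trajectory_invariant (fun p => settled p k) a (t + 1)) => //; last first.
  by rewrite at_/= ltrDl.
move=> u p /andP[au _] lp sp.
have [_ _ lv] := eta_osp.
have [q [lq ring noring]] := lv u (le_lt_trans a0 au).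
rewrite (left_value_unique lq lp) in ring noring.
have [[i iu]|nr] := pselect (exists i, rings i u).
  by rewrite (ring i iu); exact: settled_step.
by rewrite noring// => i iu; apply: nr; exists i.
Qed.

(** At a swap after [a], the left value and its exchange would both be settled, hence both without
    ascent at [k], and two distinct positions would carry the same label. *)
Lemma settled_no_swap k a t : 0 <= a -> settled (eta a) k -> swap_at eta k t -> t <= a.
Proof.
move=> a0 sa [t0 [p lp swap]]; rewrite leNgt; apply/negP => at_.
have [x [xp /andP[ax _]]] := @left_value_ex a t (fun q => q = p) at_ lp.
have sp : settled p k by rewrite -xp; exact: trajectory_settled ax.
have st : settled (eta t) k by apply: (trajectory_settled a0) => //; exact: ltW.
have := settled_no_ascent st; rewrite swap !permM tpermL tpermR => h1.
have h2 := settled_no_ascent sp.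
have : p (lpos k) = p (rpos k).
  by apply/val_inj/eqP; rewrite eqn_leq leqNgt h1 leqNgt h2.
by move/perm_inj/(congr1 val) => /=; lia.
Qed.

End trajectory.

Section osp_laplace.
Context {n : nat} {R : realType}.
Notation m := n.-1.

(** Every clock runs in every state; a ring that finds no ascent leaves the state unchanged. *)
Definition clocks (s : seq nat) : seq 'I_m := enum 'I_m.
Definition osp_move (s : seq nat) (k : 'I_m) : seq nat := osp_next k s.
Definition osp_final (s : seq nat) : bool := s == rev (iota 0 n).

Section relation.
Variables (rings : 'I_m -> set R) (eta : R -> {perm 'I_n}).
Hypothesis eta_osp : osp_trajectory rings eta.

(* S is the current time; v and u are the remaining gaps and last swap times, counted
   from S. *)
Definition osp_rel (s : seq nat) (v : 'I_m * nat -> R) (u : 'I_m -> R) : Prop :=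
  exists S, [/\ 0 <= S, code (eta S) = s, forall p, 0 < v p,
    forall (k : 'I_m) t, S < t -> rings k t <-> exists j, t = S + \sum_(l < j.+1) v (k, val l) &
    forall k : 'I_m, ~~ osp_done s k -> is_last_swap_time eta k (S + u k)].

Lemma osp_rel_final s v u : osp_rel s v u -> osp_final s -> forall k : 'I_m, osp_done s k.
Proof. by move=> _ /eqP -> k; exact: osp_done_final. Qed.

Lemma osp_rel_step s v u i : osp_rel s v u -> first_ring i (clocks s) v ->
  [/\ osp_rel (osp_move s i) (next_config i (clocks s) v) (fun k => u k - v (i, 0%N)),
      forall k : 'I_m, osp_done s k -> osp_done (osp_move s i) k &
      forall k : 'I_m, ~~ osp_done s k -> osp_done (osp_move s i) k -> u k = v (i, 0%N)].
Proof.
move=> [S [S0 sE v0 ringsE lastE]] /allP fr.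
have {}fr k : k != i -> v (i, 0%N) < v (k, 0%N).
  by move=> ki; apply: fr; rewrite mem_rem_uniq ?enum_uniq// inE ki mem_enum.
pose S' := S + v (i, 0%N).
have SS' : S < S' by rewrite ltrDl.
have S'0 : 0 < S' by rewrite (le_lt_trans S0).
have first_le k : v (i, 0%N) <= v (k, 0%N).
  by have [->|/fr/ltW] := eqVneq k i.
have sum_pos k j : 0 <= \sum_(l < j) v (k, (val l).+1).
  by apply: sumr_ge0 => l _; exact: ltW.
(* Every ring after [S] comes at [S'] or later, since the first gap of each clock is at least
   [v (i, 0)]. *)
have const t : S <= t < S' -> eta t = eta S.
  apply: (trajectory_constant eta_osp) => // k {}t /andP[St tS'] /(ringsE _ _ St)[j tE].
  move: tS'; rewrite tE big_ord_recl/= /S' ltrD2l ltNge => /negP; apply.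
  by rewrite (le_trans (first_le k))// lerDl sum_pos.
have left_S' : left_value eta S' (eta S) by exact: left_value_itv SS' const.
have [_ _ lv] := eta_osp.
have ring_i : rings i S' by apply/(ringsE _ _ SS'); exists 0%N; rewrite big_ord1.
have etaS' : eta S' = osp_step i (eta S).
  have [q [lq ring _]] := lv S' S'0.
  by rewrite (ring i ring_i) (left_value_unique lq left_S').
have sE' : code (eta S') = osp_move s i by rewrite etaS' -osp_next_code sE.
have mono (k : 'I_m) : osp_done s k -> osp_done (osp_move s i) k.
  by rewrite -sE' -sE etaS' => /osp_doneP h; apply/osp_doneP; exact: settled_step.
split=> //.
- exists S'; split => //; first exact: ltW.
  + move=> [k l]; rewrite /next_config /shift_config /sub_at /=.
    have sub p : 0 < if p \in [seq (j, 0%N) | j <- rem i (clocks s)] then v p - v (i, 0%N) else v p.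
      case: ifPn => // /mapP[j jr ->]; rewrite subr_gt0 fr//.
      by move: jr; rewrite mem_rem_uniq ?enum_uniq// inE => /andP[].
    by case: ifP => _; exact: sub.
  + move=> k t S't; rewrite ringsE; last exact: lt_trans S't.
    have [ki|ki] := eqVneq k i.
      rewrite ki; split => -[j tE].
        case: j tE => [|j] tE; first by move: S't; rewrite tE big_ord1 ltxx.
        exists j; rewrite tE big_ord_recl/= /S' -addrA; congr (_ + (_ + _)).
        by apply: eq_bigr => l _; rewrite next_config_row.
      exists j.+1; rewrite tE [X in _ = _ + X]big_ord_recl/= /S' -[LHS]addrA; congr (_ + (_ + _)).
      by apply: eq_bigr => l _; rewrite next_config_row.
    (* For the other clocks only the origin of time moves: the first gap is shortened by [v (i, 0)],
       so the ringing times are unchanged. *)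
    have sumE j : S' + \sum_(l < j.+1) next_config i (clocks s) v (k, val l) =
        S + \sum_(l < j.+1) v (k, val l).
      rewrite !big_ord_recl/= next_config_racing ?enum_uniq ?mem_enum//.
      rewrite /S' addrA -[X in X + _]addrA [v (i, 0%N) + _]addrC subrK -addrA.
      congr (_ + (_ + _)); apply: eq_bigr => l _.
      by rewrite next_config_other.
    by split => -[j tE]; exists j; rewrite tE sumE.
  + move=> k nk; rewrite /S' -addrA [v _ + _]addrC subrK; apply: lastE.
    by apply: contra nk; exact: mono.
- move=> k nk dk; have [swap last] := lastE k nk.
  (* A position that settles at this ring does so by a swap at [k] itself, and no swap at [k] can
     follow, so the last one occurs at [S']. *)
  have dS' : settled (eta S') k by apply/osp_doneP; rewrite sE'.
  have [ki stepE] : k = i /\ osp_step i (eta S) = exchange i (eta S).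
    apply: newly_settled; last by rewrite -etaS'.
    by move/osp_doneP; rewrite sE; apply/negP.
  have swap' : swap_at eta k S'.
    by split=> //; exists (eta S) => //; rewrite etaS' ki.
  apply/(addrI S)/eqP; rewrite eq_le (last _ swap') andbT.
  exact: (settled_no_swap eta_osp (ltW S'0) dS').
Qed.

End relation.

Definition osp_cost (xi : 'I_m -> R) (s : seq nat) : R := \sum_(k < m | ~~ osp_done s k) xi k.

Definition osp_limit (xi : 'I_m -> R) : seq nat -> R :=
  race_limit clocks osp_move osp_final (osp_cost xi).

Lemma osp_laplace d (T : measurableType d) (P : probability T R)
    (tau : 'I_m * nat -> {RV P >-> R}) (eta : T -> R -> {perm 'I_n})
    (U : {RV P >-> m.-tuple R}) (xi : 'I_m -> R) :
  (1 < n)%N -> iid_exponential tau 1 ->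
  {ae P, forall w, osp_trajectory (poisson_rings tau w) (eta w)} ->
  {ae P, forall w, forall k, is_last_swap_time (eta w) k (tnth (U w) k)} ->
  (forall k, 0 <= xi k) ->
  (\int[P]_w (expR (- \sum_k xi k * tnth (U w) k))%:E = (osp_limit xi (iota 0 n))%:E)%E.
Proof.
move=> n1 iidtau heta hU xi0.
have tau0 : {ae P, forall w, forall k l, 0 < tau (k, l) w}.
  (* The quantifier over [k] is moved to the natural number [j], so that countable intersections of
     almost sure events apply. *)
  have : {ae P, forall w j l (k : 'I_m), val k = j -> 0 < tau (k, l) w}.
    apply/ae_foralln => j; apply/ae_foralln => l.
    have [jm|mj] := ltnP j m; last first.
      by apply: aeW => w k kj; have := ltn_ord k; rewrite -[X in (X < _)%N]/(val k) kj ltnNge mj.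
    have := iid_exponential_gt0 iidtau (Ordinal jm, l); apply: filterS => w pos k kj.
    by rewrite (_ : k = Ordinal jm)//; exact: val_inj.
  by apply: filterS => w pos k l; exact: pos.
apply: (@integral_race_limit _ _ _ _ _ _ _ _ _ _ _ _ tau) => //.
- by move=> s; exact: enum_uniq.
- by move=> s; exact: sumr_ge0.
- apply: (@race_limit0 _ _ _ _ _ _ _ (fun s => exists p : {perm 'I_n}, s = code p) (@moment n)).
  + by move=> s; exact: enum_uniq.
  + move=> _ k [p ->] _; exists (osp_step k p); exact: osp_next_code.
  + move=> _ k [p ->] _ _; rewrite /osp_move.
    have [asc|nasc] := boolP (p (lpos k) < p (rpos k))%N; first by right; exact: moment_step.
    by left; rewrite osp_next_code /osp_step (negPf nasc).
  + move=> _ [p ->] nf.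
    have [[k asc]|nasc] := pselect (exists k, (p (lpos k) < p (rpos k))%N).
      by exists k; [rewrite mem_enum|exact: moment_step].
    case/eqP: nf; apply: code_no_ascent => k; apply/negbTE/negP => asc.
    by apply: nasc; exists k.
  + by exists 1%g; rewrite code1.
- apply: measurableT_comp => //; apply: measurableT_comp => //.
  apply: measurable_sum => k; apply: measurable_funM => //.
  by apply: (measurableT_comp (measurable_tnth k)); exact: measurable_funPT.
apply: filterS3 tau0 heta hU => w tau0w etaw Uw; split.
  rewrite expR_le1 oppr_le0 sumr_ge0// => k _; rewrite mulr_ge0//.
  by have [[/ltW]] := Uw k.
move=> N.
have notdone (k : 'I_m) : ~~ osp_done (iota 0 n) k.
  have kn : (k.+1 < n)%N := rpos_subproof k.
  apply/negP; rewrite -code1 => /osp_doneP /(_ (Ordinal (ltnW n1)) (leq0n _)).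
  by rewrite perm1 /= leqn0 subn_eq0 leqNgt kn.
have rel0 : osp_rel (poisson_rings tau w) (eta w) (iota 0 n) (config_of tau w) (fun k => tnth (U w) k).
  exists 0; split => //.
  - by have [-> _ _] := etaw; rewrite code1.
  - by case=> k l; exact: tau0w.
  - move=> k t t0; rewrite /poisson_rings /config_of; split.
      by move=> [j _ <-]; exists j; rewrite add0r.
    by move=> [j ->]; exists j => //; rewrite add0r.
  - by move=> k _; rewrite add0r; exact: Uw.
have -> := @race_value_coupling 'I_m R (seq nat) clocks osp_move osp_final m
  (fun s k => osp_done s k) xi (osp_rel (poisson_rings tau w) (eta w)) _ _ N _ _ _ rel0.
- by rewrite (eq_bigl xpredT)// => k; exact: notdone.
- by move=> s v u; exact: osp_rel_final.
- by move=> s v u i rel _ _; exact: osp_rel_step.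
Qed.

End osp_laplace.

(** * The computed tables for each [n], and the equality of laws *)

Definition table2 := Eval vm_compute in intertwiner 2.
Definition table3 := Eval vm_compute in intertwiner 3.
Definition table4 := Eval vm_compute in intertwiner 4.
Definition table5 := Eval vm_compute in intertwiner 5.
Definition table6 := Eval vm_compute in intertwiner 6.

Lemma check_table_small n : (2 <= n <= 6)%N -> exists T, check_table n T.
Proof.
case: n => [|[|[|[|[|[|[|n]]]]]]] //= _.
- by exists table2; vm_compute.
- by exists table3; vm_compute.
- by exists table4; vm_compute.
- by exists table5; vm_compute.
- by exists table6; vm_compute.
Qed.

Lemma osp_lpp_limit (R : realType) (n : nat) (xi : 'I_n.-1 -> R) : (2 <= n <= 6)%N ->
  (forall k, 0 <= xi k) -> osp_limit xi (iota 0 n) = lpp_limit xi (nseq n.-1 0%N).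
Proof.
move=> hn xi0; have [T checkT] := check_table_small hn; have /andP[n2 _] := hn.
have m0 : (0 < n.-1)%N by lia.
apply: (intertwining (ltnW n2) checkT xi0).
- by apply: race_limit_final; rewrite /osp_final.
- move=> s _ sf.
  have D0 : @clocks n s != [::] by rewrite -size_eq0 size_enum_ord -lt0n.
  have := @race_limit_step _ R _ clocks osp_move osp_final (osp_cost xi) _ s sf D0.
  rewrite size_enum_ord => ->; last by move=> s'; exact: sumr_ge0.
  rewrite -[iota 0 n.-1]val_enum_ord [RHS]big_map.
  exact: eq_bigr.
- by apply: race_limit_final.
- move=> l _ lf addl.
  have := @race_limit_step _ R _ addable grow (pred1 (full_diagram n.-1)) (lpp_cost xi) _ l lf addl.
  by apply=> l'; exact: sumr_ge0.
Qed.

(* eta is an oriented swap process driven by the clocks with gaps tau, and U is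
   a version of its random vector of last swap times. *)
Theorem theorem1p4 (R : realType) (n : nat) (hn : (2 <= n <= 6)%N)
    (d : measure_display) (T : measurableType d) (P : probability T R)
    (tau : 'I_n.-1 * nat -> {RV P >-> R})
    (htau : iid_exponential tau 1)
    (eta : T -> R -> {perm 'I_n})
    (heta : {ae P, forall w, osp_trajectory (poisson_rings tau w) (eta w)})
    (U : {RV P >-> n.-1.-tuple R})
    (hU : {ae P, forall w, forall k : 'I_n.-1,
             is_last_swap_time (eta w) k (tnth (U w) k)})
    (d' : measure_display) (T' : measurableType d') (Q : probability T' R)
    (X : nat * nat -> {RV Q >-> R})
    (hX : iid_exponential X 1) :
  forall B : set (n.-1.-tuple R), measurable B ->
    distribution P U B = distribution Q (lpp_vector n X) B.
Proof.
have /andP[n2 _] := hn.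
apply: laplace_distribution_unique.
- by apply: filterS hU => w Uw k; have [[/ltW]] := Uw k.
- have : {ae Q, forall w, forall i j, 0 <= X (i, j) w}.
    by apply/ae_foralln => i; apply/ae_foralln => j; exact: iid_exponential_ge0.
  by apply: filterS => w X0 k; rewrite tnth_mktuple; exact: lpp_ge0.
- move=> xi xi0.
  by rewrite (osp_laplace n2 htau heta hU xi0) (lpp_vector_laplace hX xi0) osp_lpp_limit.
Qed.
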